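(* Let $t \geq 2$ and $1 \leq k_1 \leq \cdots \leq k_t$ be integers with $n = k_1 + \cdots + k_t \geq 4$, and let $X$ be a graph on $n$ vertices. Then: \begin{enumerate} \item If $t = 2$ and $k_1 \geq 2$, then $\mathsf{FS}(X, K_{k_1, n-k_1})$ is connected if $X$ is connected, is non-bipartite, is not a cycle, and does not contain a $k_1$-bridge. \item If $t > 2$ and either $k_t > 2$ or $\gcd(k_1,\ldots,k_t) > 1$, then $\mathsf{FS}(X, K_{k_1,\ldots,k_t})$ is connected if $X$ is connected, is not a cycle, is not a tree, and does not contain an $(n-k_t)$-bridge. \item If $t > 2$, $k_1 = 1$, and $k_t = 2$, then $\mathsf{FS}(X, K_{k_1,\ldots,k_t})$ is connected if $X$ is connected, is not a cycle, and is not a tree. \end{enumerate}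
   Context: All graphs are simple. For graphs $X, Y$ on $n$ vertices, the friends-and-strangers graph $\mathsf{FS}(X,Y)$ has as vertices all bijections $\sigma: V(X) \to V(Y)$; two bijections $\sigma, \sigma'$ are adjacent iff there is an edge $\{a,b\} \in E(X)$ with $\{\sigma(a),\sigma(b)\} \in E(Y)$, $\sigma'(a) = \sigma(b)$, $\sigma'(b) = \sigma(a)$, and $\sigma'(c) = \sigma(c)$ for all other $c$. $K_{k_1,\ldots,k_t}$ denotes the complete $t$-partite graph with partition classes of sizes $k_1,\ldots,k_t$. A path $v_1, \ldots, v_k$ in a graph is a $k$-bridge if each edge of the path is a cut-edge, $v_2,\ldots,v_{k-1}$ have degree $2$, and $v_1, v_k$ do not have degree $1$; a single cut-vertex is a $1$-bridge. *)

(* Defs.v *)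
From HB Require Import structures.
From mathcomp Require Import all_boot.

Set Implicit Arguments.
Unset Strict Implicit.
Unset Printing Implicit Defensive.

Record sgraph := SGraph {
  vertex :> finType;
  edge : rel vertex;
  edge_sym : symmetric edge;
  edge_irr : irreflexive edge }.

Section Graphs.
Variable G : sgraph.
Implicit Types x y u v : G.

Definition degree x := #|[set y | edge x y]|.

Definition ncomponents := n_comp (@edge G) predT.

Definition connected := 0 < #|G| /\ forall x y, connect (@edge G) x y.

Definition bipartite := exists c : G -> bool, forall x y, edge x y -> c x != c y.

Definition is_cycle := exists s : seq G,
  [/\ 2 < size s, uniq s, forall x, x \in s &
      forall x y, edge x y = (y == next s x) || (x == next s y)].

Definition acyclic := forall s : seq G, ucycle (@edge G) s -> size s < 3.

Definition is_tree := connected /\ acyclic.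

Definition del_edge_rel x y : rel G :=
  [rel u v | edge u v && ([set u; v] != [set x; y])].

Lemma del_edge_sym x y : symmetric (del_edge_rel x y).
Proof. by move=> u v; rewrite /del_edge_rel /= edge_sym setUC. Qed.

Lemma del_edge_irr x y : irreflexive (del_edge_rel x y).
Proof. by move=> u; rewrite /del_edge_rel /= edge_irr. Qed.

Definition del_edge x y := SGraph (del_edge_sym x y) (del_edge_irr x y).

Definition del_vertex_rel x : rel {y : G | y != x} :=
  [rel u v | edge (val u) (val v)].

Lemma del_vertex_sym x : symmetric (@del_vertex_rel x).
Proof. by move=> u v; apply: edge_sym. Qed.

Lemma del_vertex_irr x : irreflexive (@del_vertex_rel x).
Proof. by move=> u; apply: edge_irr. Qed.

Definition del_vertex x := SGraph (@del_vertex_sym x) (@del_vertex_irr x).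

End Graphs.

Definition cut_edge (G : sgraph) : rel G :=
  [rel x y | edge x y && (ncomponents G < ncomponents (del_edge x y))].

Definition cut_vertex (G : sgraph) : pred G :=
  [pred x | ncomponents G < ncomponents (del_vertex x)].

(* For s = v_1 :: p of size at least 2, behead (belast v_1 p) lists the        *)
(* internal vertices of the path s.                                           *)
Definition bridge (G : sgraph) (s : seq G) : bool :=
  match s with
  | [::] => false
  | [:: v] => cut_vertex v
  | v1 :: p =>
      [&& uniq s, path (@cut_edge G) v1 p,
          all (fun v => degree v == 2) (behead (belast v1 p)),
          degree v1 != 1 & degree (last v1 p) != 1]
  end.

Definition has_bridge (G : sgraph) (k : nat) :=
  exists s : seq G, size s = k /\ bridge s.

(* The i-th part is 'I_(nth 0 k i), for i < size k.                           *)
Section CompleteMultipartite.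
Variable k : seq nat.

Definition cmp_vertex : finType := {i : 'I_(size k) & 'I_(nth 0 k i)}.

Definition cmp_rel : rel cmp_vertex := [rel u v | tag u != tag v].

Lemma cmp_sym : symmetric cmp_rel.
Proof. by move=> u v; rewrite /cmp_rel /= eq_sym. Qed.

Lemma cmp_irr : irreflexive cmp_rel.
Proof. by move=> u; rewrite /cmp_rel /= eqxx. Qed.

Definition complete_multipartite := SGraph cmp_sym cmp_irr.

End CompleteMultipartite.

Section FriendsAndStrangers.
Variables X Y : sgraph.

Definition bijectiveb (f : {ffun X -> Y}) :=
  injectiveb f && [forall y, y \in codom f].

Definition FS_vertex : finType := {f : {ffun X -> Y} | bijectiveb f}.

Definition FS_rel : rel FS_vertex := [rel s s' : FS_vertex |
  [exists a, exists b,
    [&& edge a b, edge (val s a) (val s b),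
        val s' a == val s b, val s' b == val s a &
        [forall c, (c != a) && (c != b) ==> (val s' c == val s c)]]]].

Lemma FS_sym : symmetric FS_rel.
Proof.
have FSW s s' : FS_rel s s' -> FS_rel s' s.
  case/existsP=> a /existsP[b /and5P[ab sab /eqP ea /eqP eb /forallP ec]].
  apply/existsP; exists a; apply/existsP; exists b.
  rewrite ab ea eb edge_sym sab !eqxx /=; apply/forallP=> c.
  by rewrite [val s c == _]eq_sym; apply: ec.
by move=> s s'; apply/idP/idP; apply: FSW.
Qed.

Lemma FS_irr : irreflexive FS_rel.
Proof.
move=> s; apply/negbTE/negP; rewrite /FS_rel /=.
case/existsP=> a /existsP[b /and5P[_ sab /eqP ea _ _]].
by rewrite ea edge_irr in sab.
Qed.

Definition FS := SGraph FS_sym FS_irr.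

End FriendsAndStrangers.

(* Main.v *)
(* Fix a colour class of Y and call its members tokens and all others blanks. *)
(* Colour-preserving permutations of V(Y) act on FS(X, Y), so whether two     *)
(* tokens can be exchanged does not change along a walk in FS(X, Y), and any  *)
(* colouring of the positions can be reached. It therefore suffices to        *)
(* exchange two tokens when the set U of blank positions is connected. At a   *)
(* claw holding two blanks and two tokens, six swaps exchange the tokens and  *)
(* also the blanks. The tokens next to U are all exchangeable: either U       *)
(* contains a vertex of degree at least 3 with two neighbours in U, or U is a *)
(* path with inner degrees 2. In the latter case, unless the path ends in a   *)
(* leaf or is a #|U|-bridge, it lies on a chordless cycle, around which       *)
(* everything can be rotated to a vertex of degree at least 3. Moving U about *)
(* then gives all tokens.                                                     *)
(* With three colours the two blanks of the claw can be given different       *)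
(* colours and swapped back, so every transposition of tokens is realised.    *)
(* With two colours one gets every (x y) times some (b b') of the other class.*)
(* As X is not bipartite, some odd permutation is realised as well; it can be *)
(* concentrated on a single class, whose realised permutations are normal in  *)
(* the symmetric group, hence contain all transpositions.                     *)

Require Import Defs.
From HB Require Import structures.
From mathcomp Require Import all_boot all_fingroup.

Set Implicit Arguments.
Unset Strict Implicit.
Unset Printing Implicit Defensive.

(** The combinatorial half only tracks the set [U] of blank positions and two tokens, through
    [exch]. [exch_pair] settles two tokens in a connected set with a vertex that has three
    neighbours inside it. [exch_boundary] deduces that tokens adjacent to a connected [U] are
    exchangeable: by [exch_boundary_branch] if [U] supplies such a vertex, otherwise by
    [exch_boundary_thin], where [U] is a path and the absence of a bridge closes it up to a cycle.
    [exch_all] then reaches distant tokens by letting [U] creep towards them.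

    The algebraic half writes a state as a permutation sending positions to occupants:
    multiplication on the left moves occupants, multiplication on the right relabels them. The
    relabellings [g] with [loop s g] form a group that is constant along walks, and by [reach_all]
    connectedness follows once it contains the transposition of any two equally coloured neighbours.
    If blanks of two colours exist, [exch_pure] turns an exchange into that transposition. With two
    colours [exch_double] yields only a product of two transpositions, one in each class; then
    [odd_loop] supplies an odd element, [loop_concentrate] pushes it into one class, and
    [transpositions_of_odd] extracts every transposition there.

    The assumption on a single bridge length serves all classes because a bridge can be shortened
    ([has_bridge_le]). In the third item every class has at most two members, and [exch_two] takes
    the place of [exch_all]. *)

Lemma distance_exists (T : finType) (e : rel T) v :
  exists d : T -> nat,
    [/\ d v = 0, forall x y, e x y -> d x <= (d y).+1
      & forall x, connect e x v -> x != v ->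
          exists y, [/\ e x y, connect e y v & d x = (d y).+1]].
Proof.
pose P x n := [exists t : n.-tuple T, path e x t && (last x t == v)].
(* If [v] cannot be reached from [x] the search fails and [d x] is [#|T|], so the inequality along
   edges also holds off the component of [v]. *)
pose d x := find (P x) (iota 0 #|T|).
have dle x n : P x n -> d x <= n.
  move=> Pn; case: (ltnP n #|T|) => hn; last first.
    by apply: leq_trans hn; rewrite -[X in _ <= X](size_iota 0); apply: find_size.
  rewrite leqNgt; apply/negP => lt.
  by have := before_find 0 lt; rewrite nth_iota // add0n Pn.
have dP x : connect e x v -> P x (d x).
  case/connectP=> p ep; case: (shortenP ep) => p' ep' up' _ vl.
  suff h : has (P x) (iota 0 #|T|).
    have := nth_find 0 h; rewrite nth_iota ?add0n //.
    by move: h; rewrite has_find size_iota.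
  apply/hasP; exists (size p').
    by rewrite mem_iota /= add0n; have := max_card [in x :: p']; rewrite (card_uniqP up').
  apply/existsP; exists (in_tuple p') => /=.
  by rewrite ep' -vl eqxx.
have PS x y n : e x y -> P y n -> P x n.+1.
  move=> exy /existsP[t /andP[pt lt]].
  by apply/existsP; exists [tuple of y :: t]; rewrite /= exy pt lt.
have dS x y : e x y -> d x <= (d y).+1.
  move=> exy; case: (boolP (P y (d y))) => [/(PS _ _ _ exy)/dle //|nP].
  have nc : d y = #|T|.
    apply/eqP; rewrite eqn_leq -{1}[X in _ <= X](size_iota 0) find_size /=.
    rewrite leqNgt; apply/negP => lt; case/negP: nP.
    rewrite -[X in P y X]add0n -(@nth_iota 0 0 #|T|) //.
    by apply: nth_find; rewrite has_find size_iota.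
  by rewrite nc ltnW // ltnS -[X in _ <= X](size_iota 0) find_size.
exists d; split => //.
  apply/eqP; rewrite -leqn0; apply: dle.
  by apply/existsP; exists [tuple]; rewrite /= eqxx.
move=> x cx nxv; have := dP x cx; case E: (d x) => [|n].
  by case/existsP=> t; rewrite tuple0 /= (negPf nxv).
case/existsP=> t; case/tupleP: t => y t /=; case/andP=> /andP[exy pt] lt.
exists y; split => //; first by apply/connectP; exists t => //; rewrite (eqP lt).
congr S; apply/eqP; rewrite eqn_leq -ltnS -E (dS _ _ exy) /=.
by apply: dle; apply/existsP; exists t; rewrite pt.
Qed.

(** * Exchanging tokens among blanks *)

Section Exchange.
Variable X : sgraph.
Implicit Types (U H : {set X}) (a b u v w : X).

Definition induced U : rel X := [rel x y | [&& edge x y, x \in U & y \in U]].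

Definition set_connected U :=
  forall x y, x \in U -> y \in U -> connect (induced U) x y.

(* U is the set of blank positions; exch U a b means that the tokens at a and *)
(* b can be exchanged whenever the blanks are at U. Transitivity needs U to   *)
(* be connected because, with several blank colours, only then can the blanks *)
(* be put back in the arrangement that the second exchange requires.          *)
Inductive exch : {set X} -> X -> X -> Prop :=
| exch_refl U a : a \notin U -> exch U a a
| exch_trans U a b c : set_connected U -> exch U a b -> exch U b c -> exch U a c
| exch_claw U v w a b :
    v \in U -> w \in U -> a \notin U -> b \notin U -> a != b ->
    edge v w -> edge v a -> edge v b -> exch U a b
| exch_move U u v a b :
    edge u v -> u \in U -> v \notin U -> exch U a b ->
    exch (tperm u v @: U) (tperm u v a) (tperm u v b).

Lemma exch_sym U a b : exch U a b -> exch U b a.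
Proof.
elim=> {U a b} [U a|U a b c cU _ IH1 _ IH2|U v w a b vU wU aU bU ab vw va vb|U u v a b uv uU vU _ IH].
- exact: exch_refl.
- exact: exch_trans IH2 IH1.
- by apply: (exch_claw vU wU); rewrite // eq_sym.
- exact: exch_move.
Qed.

Lemma induced_sym U : symmetric (induced U).
Proof. by move=> x y; rewrite /induced /= edge_sym [(x \in U) && _]andbC. Qed.

Lemma exch_slide U u v b :
  edge u v -> u \in U -> v \notin U -> b \notin U -> b != v ->
  exch U v b -> exch (v |: U :\ u) u b.
Proof.
move=> uv uU vU bU bv E; have := exch_move uv uU vU E.
have bu : b != u by apply: contraNneq bU => ->.
rewrite tpermR tpermD 1?eq_sym //.
suff -> : tperm u v @: U = v |: U :\ u by [].
apply/setP=> z; rewrite !inE; apply/imsetP/idP => [[y yU ->]|].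
  case: tpermP => [yu|yv|/eqP yu /eqP yv]; rewrite ?eqxx //.
    by rewrite yv (negPf vU) in yU.
  by rewrite yu yU orbT.
case/orP=> [/eqP ->|/andP[zu zU]]; first by exists u; rewrite ?tpermL.
exists z => //; rewrite tpermD // eq_sym //.
by apply: contraNneq vU => <-.
Qed.

Lemma rank_exists H v :
  set_connected H -> v \in H ->
  exists d : X -> nat, [/\ d v = 0, forall x y, induced H x y -> d x <= (d y).+1
    & forall x, x \in H -> x != v -> exists y, induced H x y /\ d x = (d y).+1].
Proof.
move=> cH vH; have [d [d0 d1 d2]] := distance_exists (induced H) v.
exists d; split => // x xH xv.
by have [y [exy _ dxy]] := d2 x (cH _ _ xH vH) xv; exists y.
Qed.

(** All of [H] is blank except for the two tokens, so the first one is free to step from [a] to [c];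
    undoing the step transports the exchange. *)
Lemma exch_step H a c b :
  a \in H -> c \in H -> b \in H -> a != b -> c != b -> edge a c ->
  exch (H :\ c :\ b) c b -> exch (H :\ a :\ b) a b.
Proof.
move=> aH cH bH ab cb ac E.
have ca : c != a by apply: contraTneq ac => ->; rewrite edge_irr.
have := @exch_slide (H :\ c :\ b) a c b ac.
rewrite !inE ab aH !eqxx [a == c]eq_sym ca /= andbF.
move=> /(_ isT isT isT); rewrite eq_sym => /(_ cb E).
suff -> : c |: (H :\ c :\ b) :\ a = H :\ a :\ b by [].
apply/setP=> z; rewrite !inE; case: (eqVneq z c) => [->|] /=.
  by rewrite cb ca cH.
by rewrite [(z != a) && _]andbC -!andbA [(z \in H) && _]andbC.
Qed.

(** The tokens walk towards the branch vertex [v] until one stands on [v] and the other next to it.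
    The induction is on the sum of their distances to [v]. *)
Lemma exch_pair H v a b :
  set_connected H -> v \in H -> 2 < #|[set y in H | edge v y]| ->
  a \in H -> b \in H -> a != b -> exch (H :\ a :\ b) a b.
Proof.
move=> cH vH v3; have [d [d0 _ dS]] := rank_exists cH vH.
(* The token on [v] retreats to a second neighbour [w]; the blank third neighbour [w'] then
   completes a claw at [v]. *)
have base x : x \in H -> edge v x -> exch (H :\ v :\ x) v x.
  move=> xH vx; set N := [set y in H | edge v y] in v3.
  have /card_gt0P[w] : 0 < #|N :\ x|.
    by move: v3; rewrite (cardsD1 x) inE xH vx /= add1n ltnS => /ltnW.
  rewrite !inE => /and3P[wx wH vw].
  have /card_gt0P[w'] : 0 < #|N :\ x :\ w|.
    move: v3; rewrite (cardsD1 x) inE xH vx /= add1n ltnS.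
    by rewrite (cardsD1 w) !inE wx wH vw.
  rewrite !inE => /and4P[w'w w'x w'H vw'].
  have vNx : v != x by apply: contraTneq vx => ->; rewrite edge_irr.
  apply: (exch_step vH wH xH) => //.
  have vNw : v != w by apply: contraTneq vw => ->; rewrite edge_irr.
  by apply: (@exch_claw _ v w'); rewrite ?inE ?vNx ?vNw ?w'x ?w'w ?eqxx ?andbF.
have [n] := ubnP (d a + d b); elim: n a b => // n IH a b.
rewrite ltnS => dab aH bH ab.
have swapD x y : H :\ x :\ y = H :\ y :\ x.
  by apply/setP=> z; rewrite !inE !andbA [(z != x) && _]andbC.
have [av|av] := eqVneq a v.
  have bv : b != v by rewrite -av eq_sym.
  have [c [/and3P[bc _ cH'] dbc]] := dS b bH bv.
  have [cv|cv] := eqVneq c v; first by rewrite av; apply: base => //; rewrite edge_sym -cv.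
  rewrite swapD; apply: exch_sym; apply: (exch_step bH cH' aH) => //.
  - by rewrite eq_sym.
  - by rewrite av.
  rewrite swapD; apply: exch_sym; apply: IH => //; last by rewrite av eq_sym.
  by apply: leq_trans dab; rewrite dbc addnS.
have [c [/and3P[ac _ cH'] dac]] := dS a aH av.
have [cb|cb] := eqVneq c b; last first.
  by apply: (exch_step aH cH' bH) => //; apply: IH => //; apply: leq_trans dab; rewrite dac.
(* Here [b] blocks the way of [a]; it is the closer one, so it moves first. *)
have [bv|bv] := eqVneq b v.
  rewrite swapD; apply: exch_sym; rewrite bv; apply: base => //.
  by rewrite -bv -cb edge_sym.
have [c' [/and3P[bc' _ cH''] dbc']] := dS b bH bv.
have c'a : c' != a by apply: contra_eq_neq dbc' => ->; rewrite dac cb neq_ltn ltnS leqW.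
rewrite swapD; apply: exch_sym; apply: (exch_step bH cH'' aH) => //; first by rewrite eq_sym.
rewrite swapD; apply: exch_sym; apply: IH => //; last by rewrite eq_sym.
by apply: leq_trans dab; rewrite dbc' addnS.
Qed.

End Exchange.

(** * Rotating a cycle *)

Section Rotation.
Variable X : sgraph.
Implicit Types (U H : {set X}) (a b u v w x y z : X) (p D : seq X).

Lemma exch_notin U a b : exch U a b -> a \notin U /\ b \notin U.
Proof.
elim=> {U a b} [//|U a b c _ _ [? ?] _ [? ?]//|//|U u v a b _ _ _ _ [? ?]].
by rewrite !mem_imset //; apply: perm_inj.
Qed.

Lemma exch_swap U u v a b :
  edge u v -> u \in U -> exch U a b ->
  exch (tperm u v @: U) (tperm u v a) (tperm u v b).
Proof.
move=> uv uU E; case: (boolP (v \in U)) => vU; last exact: exch_move.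
have [aU bU] := exch_notin E.
have fixN z : z \notin U -> tperm u v z = z.
  by move=> zU; rewrite tpermD //; apply: contraNneq zU => <-.
rewrite !fixN //; suff -> : tperm u v @: U = U by [].
apply/eqP; rewrite eqEcard card_imset ?leqnn ?andbT; last exact: perm_inj.
by apply/subsetP=> _ /imsetP[y yU ->]; case: tpermP => // _.
Qed.

(** Effect of a blank walking from [x] along [p]: every occupant of [p] falls back one place. For a
    simple path [x] is absent from [p], so its index is [size p] and it lands on the last vertex. *)
Definition walk_map x p z := if z \in x :: p then nth x (x :: p) (index z p) else z.

Lemma exch_walk p x U a b :
  path (@edge X) x p -> uniq (x :: p) -> x \in U -> exch U a b ->
  exch (walk_map x p @: U) (walk_map x p a) (walk_map x p b).
Proof.
elim: p x U a b => [|y p IH] x U a b.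
  have E z : walk_map x [::] z = z.
    by rewrite /walk_map inE; case: eqVneq => //= ->.
  move=> _ _ _; rewrite !E; suff -> : walk_map x [::] @: U = U by [].
  by rewrite -[RHS]imset_id; apply: eq_imset => z; rewrite E.
move=> /= /andP[xy yp] /andP[xNp uyp] xU E.
have := IH y _ _ _ yp uyp _ (exch_swap xy xU E).
have W z : walk_map x (y :: p) z = walk_map y p (tperm x y z).
  rewrite /walk_map; have [yNp up] := andP uyp; case: tpermP => [->|->|/eqP zx /eqP zy].
  - by rewrite !mem_head (memNindex xNp) (memNindex yNp) -!last_nth.
  - by rewrite (negPf xNp) !inE eqxx orbT /= eqxx.
  rewrite !inE (negPf zx) (negPf zy) /= eq_sym (negPf zy).
  case: ifP => // zp; apply: set_nth_default.
  by rewrite /= !ltnS index_size.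
rewrite !W => /(_ _)/=; rewrite -imset_comp.
rewrite (eq_imset _ W); apply.
by apply/imsetP; exists x; rewrite ?tpermL.
Qed.

(* A single blank travelling once round the cycle D shifts every occupant of  *)
(* D, tokens and blanks alike, by one step.                                   *)
Lemma exch_rotate D U a b :
  path.cycle (@edge X) D -> uniq D -> has [in U] D -> exch U a b ->
  exch (next D @: U) (next D a) (next D b).
Proof.
move=> cD uD /hasP[z zD zU] E.
(* The blank runs against the orientation of [D], so that the occupants advance by [next D]. *)
have [i p rD] := @rot_to _ (rev D) z (etrans (mem_rev D z) zD).
have uzp : uniq (z :: p) by rewrite -rD rot_uniq rev_uniq.
have czp : path.cycle (@edge X) (z :: p).
  rewrite -rD rot_cycle rev_cycle; rewrite (eq_cycle (e' := @edge X)) //.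
  by move=> x y; rewrite edge_sym.
have N : next D =1 walk_map z p.
  move=> y; rewrite -prev_rev // -(prev_rot i) ?rev_uniq // rD prev_nth.
  by rewrite /walk_map.
rewrite !N (eq_imset _ N); apply: exch_walk => //.
by move: czp; rewrite /= rcons_path => /andP[].
Qed.

Lemma exch_rotates D U a b i :
  path.cycle (@edge X) D -> uniq D -> has [in U] D -> exch U a b ->
  exch (iter i (next D) @: U) (iter i (next D) a) (iter i (next D) b).
Proof.
move=> cD uD hU E; suff [] : exch (iter i (next D) @: U) (iter i (next D) a)
   (iter i (next D) b) /\ has [in iter i (next D) @: U] D by [].
elim: i => [|i [IH hi]] /=; first by rewrite imset_id.
have -> : (fun x => next D (iter i (next D) x)) @: U = next D @: (iter i (next D) @: U).
  by rewrite -imset_comp.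
split; first exact: exch_rotate.
case/hasP: hi => z zD zU; apply/hasP; exists (next D z); rewrite ?mem_next //=.
exact: imset_f.
Qed.

Lemma next_inj D : uniq D -> injective (next D).
Proof. by move=> uD; apply: can_inj (prev_next uD). Qed.

Lemma edge_next D z : path.cycle (@edge X) D -> z \in D -> edge z (next D z).
Proof. exact: next_cycle. Qed.

Lemma next_fix D z : z \notin D -> next D z = z.
Proof. by move=> zD; rewrite next_nth (negPf zD). Qed.

Lemma iter_next_size D z : uniq D -> iter (size D) (next D) z = z.
Proof.
move=> uD; case: (boolP (z \in D)) => zD.
  by rewrite -(order_cycle (cycle_next uD) uD zD) (iter_order_cycle (cycle_next uD)).
by elim: (size D) => //= i ->; apply: next_fix.
Qed.

Lemma iter_next_mem D i z : (iter i (next D) z \in D) = (z \in D).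
Proof. by elim: i => //= i <-; rewrite mem_next. Qed.

(* Rotate the blank z to v, let the token at z2 meet w there, rotate back.    *)
Lemma exch_gap D U v w z z1 z2 :
  path.cycle (@edge X) D -> uniq D -> v \in D -> w \notin D -> edge v w -> w \notin U ->
  z \in D -> z \in U -> z1 \in U -> z2 \notin U ->
  (z = next D z1 /\ z2 = next D z) \/ (z1 = next D z /\ z = next D z2) ->
  exch U z2 w.
Proof.
move=> cD uD vD wD vw wU zD zU z1U z2U zz.
have cn : fconnect (next D) z v by rewrite (fconnect_cycle (cycle_next uD)).
have ivz := iter_findex cn; set i := findex _ _ _ in ivz.
have le_i : i <= size D.
  by apply: ltnW; rewrite -(order_cycle (cycle_next uD) uD zD) findex_max.
have injI : injective (iter i (next D)) by elim: {ivz le_i}i => //= i IH x y /(next_inj uD)/IH.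
have fixI j x : x \notin D -> iter j (next D) x = x.
  by move=> xD; elim: j => //= j ->; exact: next_fix.
have back x : iter (size D - i) (next D) (iter i (next D) x) = x.
  by rewrite -iterD subnK // iter_next_size.
have eI x : x \in D -> edge (iter i (next D) x) (iter i (next D) (next D x)).
  by move=> xD; rewrite -iterSr /=; apply: edge_next; rewrite // iter_next_mem.
suff E : exch (iter i (next D) @: U) (iter i (next D) z2) w.
  have := @exch_rotates D _ _ _ (size D - i) cD uD _ E.
  rewrite -imset_comp (eq_imset (g := id) _ back) imset_id back fixI //; apply.
  by apply/hasP; exists v; rewrite //= -ivz imset_f.
have z12D : (z1 \in D) /\ (z2 \in D).
  case: zz => [] [e1 e2]; move: zD; first by rewrite e2 mem_next e1 mem_next.
  by rewrite e1 mem_next {1}e2 mem_next e2 mem_next.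
have [z1D z2D] := z12D.
have Nv x : (z = next D x) \/ (x = next D z) -> x \in D -> edge v (iter i (next D) x).
  rewrite -ivz => -[] e xD; last by rewrite e eI.
  by rewrite e edge_sym eI.
apply: (@exch_claw _ _ v (iter i (next D) z1)) => //.
- by rewrite -ivz imset_f.
- by rewrite imset_f.
- by rewrite mem_imset.
- by rewrite -(fixI i w wD) mem_imset.
- by apply: contraNneq wD => <-; rewrite iter_next_mem.
- by apply: Nv => //; case: zz => [] []; [left|right].
- by apply: Nv => //; case: zz => [] []; [right|left].
Qed.

Lemma next_neq_prev D v : uniq D -> 2 < size D -> v \in D -> next D v != prev D v.
Proof.
move=> uD sD vD; have [i p rD] := rot_to vD.
have up : uniq (v :: p) by rewrite -rD rot_uniq.
rewrite -(next_rot i) // -(prev_rot i) // rD.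
have : 2 < size (v :: p) by rewrite -rD size_rot.
case: p up {rD} => [|y [|y' p]] // up _.
have [vN /andP[yN _]] := andP up.
rewrite prev_nth mem_head memNindex // -last_nth /= eqxx.
by apply: contraNneq yN => -> /=; apply: mem_last.
Qed.

Lemma nbrs_cycle D v :
  path.cycle (@edge X) D -> uniq D -> 2 < size D -> v \in D -> degree v <= 2 ->
  [set y | edge v y] = [set next D v; prev D v].
Proof.
move=> cD uD sD vD dv; apply/esym/eqP.
rewrite eqEcard cards2 (next_neq_prev uD sD vD) [_ <= _]dv andbT.
apply/subsetP=> y; rewrite !inE => /orP[] /eqP ->; first exact: edge_next.
by rewrite edge_sym; apply: prev_cycle.
Qed.

(** The two cycle neighbours exhaust the neighbourhood of each vertex of [D], so [D] is closed under
    edges and, by connectedness, is everything. *)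
Lemma cycle_degree_le2 D :
  connected X -> path.cycle (@edge X) D -> uniq D -> 2 < size D ->
  (forall v, v \in D -> degree v <= 2) -> is_cycle X.
Proof.
move=> [_ cX] cD uD sD dD; exists D.
have nb v : v \in D -> [set y | edge v y] = [set next D v; prev D v].
  by move=> vD; apply: nbrs_cycle => //; apply: dD.
have cl : closed (@edge X) [in D].
  apply: intro_closed; first exact: sym_connect_sym (@edge_sym X).
  move=> x y xy xD; have : y \in [set y | edge x y] by rewrite inE.
  by rewrite nb // !inE => /orP[] /eqP ->; rewrite ?mem_next ?mem_prev.
have allD x : x \in D.
  case: D sD cl {cD uD dD nb} => // z D _ cl.
  by have := closed_connect cl (cX z x); rewrite mem_head => /esym.
split=> // x y; have := allD x => /nb/setP/(_ y); rewrite !inE => ->.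
congr (_ || _); apply/eqP/eqP => ->; last by rewrite prev_next.
by rewrite next_prev.
Qed.

End Rotation.

Lemma connect_crossing (T : finType) (e : rel T) (A : pred T) x y :
  connect e x y -> A x -> ~~ A y -> exists z z', [/\ e z z', A z & ~~ A z'].
Proof.
case/connectP=> p; elim: p x => /= [x _ ->|z p IH x /andP[xz zp] yl Ax Ay].
  by move=> ->.
by case: (boolP (A z)) => Az; [apply: (IH z)|exists x, z].
Qed.

Lemma next_nth_lt (T : eqType) (x0 : T) s i :
  uniq s -> i.+1 < size s -> next s (nth x0 s i) = nth x0 s i.+1.
Proof.
move=> us lt; rewrite next_nth mem_nth 1?ltnW // index_uniq // 1?ltnW //.
by case: s us lt => // y s _ lt; apply: set_nth_default.
Qed.

(** * Tokens next to the blanks *)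

Section CutEdges.
Variable X : sgraph.

(** A connected graph has one component, while [Z] separates [x] from [y] once the edge between them
    is deleted. *)
Lemma cut_edge_of_closed (Z : pred X) x y :
  connected X -> edge x y -> Z x -> ~~ Z y ->
  (forall u v, del_edge_rel x y u v -> Z u -> Z v) -> cut_edge x y.
Proof.
move=> [_ cX] xy Zx Zy clZ; rewrite /cut_edge /= xy /=.
have sX : connect_sym (@edge X) := sym_connect_sym (@edge_sym X).
have sD : connect_sym (del_edge_rel x y) := sym_connect_sym (@del_edge_sym X x y).
have -> : ncomponents X = 1.
  rewrite /ncomponents -(n_comp_connect sX x); apply: eq_n_comp_r => z.
  by rewrite !inE cX.
apply/card_gt1P; exists (root (del_edge_rel x y) x), (root (del_edge_rel x y) y).
split; rewrite ?inE ?roots_root // root_connect //.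
apply/negP => c; have clZ' : closed (del_edge_rel x y) Z by apply: intro_closed.
by have := closed_connect clZ' c; rewrite !unfold_in Zx (negPf Zy).
Qed.

(** A proper prefix works: its last vertex was an inner vertex of the longer bridge, so it has
    degree 2 and in particular not 1. *)
Lemma has_bridge_le j k : 1 < j -> j <= k -> has_bridge X k -> has_bridge X j.
Proof.
move=> j1 jk [s [ss bs]]; case: (ltngtP j k) jk => // [jk _|-> _]; last by exists s.
exists (take j s); rewrite size_take ss jk; split => //.
case: s ss bs => [|x [|y p]] // ss.
  by move: j1; rewrite -ss in jk; case: j jk => [|[]].
move: j1 jk; rewrite -ss; case: j => [|[|j]] // _; rewrite /= !ltnS => jp.
case/and5P=> /= /andP[xN uyp] /andP[xy pth] al dx dl.
have jlt : j < size p by [].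
have e : p = take j p ++ drop j p by rewrite cat_take_drop.
have dne : drop j p != [::] by rewrite -size_eq0 size_drop subn_eq0 -ltnNge.
apply/and5P; split => //=.
- move: xN uyp; rewrite {1 2 3}e /= !inE mem_cat !negb_or cat_uniq.
  by move=> /and3P[-> -> _] /andP[+ /and3P[-> _ _]]; rewrite mem_cat negb_or => /andP[-> _].
- by rewrite xy; move: pth; rewrite {1}e cat_path => /andP[].
- move: al; rewrite {1}e belast_cat all_cat => /andP[] //.
- suff: degree (last y (take j p)) == 2 by move/eqP->.
  move: al; rewrite {1}e belast_cat all_cat => /andP[_].
  by case: (drop j p) dne => // z q _ /= /andP[].
Qed.

End CutEdges.

Section Boundary.
Variables (X : sgraph) (U : {set X}).
Hypothesis cU : set_connected U.
Implicit Types (a b u v w x y z : X).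

Definition boundary a := a \notin U /\ exists2 u, u \in U & edge u a.

Lemma set_connected_from (H : {set X}) v :
  (forall x, x \in H -> connect (induced H) x v) -> set_connected H.
Proof.
move=> cH x y xH yH; apply: connect_trans (cH x xH) _.
by rewrite (sym_connect_sym (@induced_sym X H)) cH.
Qed.

Lemma connect_induced_sub (H H' : {set X}) x y :
  H \subset H' -> connect (induced H) x y -> connect (induced H') x y.
Proof.
move=> /subsetP sH; apply: connect_sub => u v /and3P[uv uH vH].
by apply: connect1; apply/and3P; rewrite uv !sH.
Qed.

Lemma set_connected_add (H : {set X}) u a :
  set_connected H -> u \in H -> edge u a -> set_connected (a |: H).
Proof.
move=> cH uH ua; apply: (@set_connected_from _ u) => x; rewrite in_setU1.
case/predU1P=> [->|xH]; last by apply: connect_induced_sub (subsetUr _ _) (cH _ _ _ _).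
by apply: connect1; apply/and3P; rewrite edge_sym ua !inE eqxx uH orbT.
Qed.

Lemma exch_boundary_pair a b v :
  boundary a -> boundary b -> v \in U ->
  2 < #|[set y in a |: (b |: U) | edge v y]| -> exch U a b.
Proof.
move=> [aU [u uU ua]] [bU [u' u'U u'b]] vU v3.
have [->|ab] := eqVneq a b; first exact: exch_refl.
have -> : U = (a |: (b |: U)) :\ a :\ b.
  apply/setP=> z; rewrite !inE; case: (eqVneq z b) => [->|_] /=; first exact/negbTE.
  by case: (eqVneq z a) => [->|_] //=; apply/negbTE.
apply: exch_pair (v3) _ _ ab; rewrite ?inE ?eqxx ?vU ?orbT //.
apply: (@set_connected_add _ u) => //; last by rewrite !inE uU orbT.
exact: (@set_connected_add _ u').
Qed.

(** If [v] has only two neighbours in [U], it has a neighbour [w] outside. Adding [w] and any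
    boundary vertex [c] to [U] gives [v] three neighbours, so each [c] can be exchanged with [w]. *)
Lemma exch_boundary_branch a b v :
  boundary a -> boundary b -> v \in U -> 2 < degree v ->
  1 < #|[set y in U | edge v y]| -> exch U a b.
Proof.
move=> Ba Bb vU dv vU2; set N := [set y in U | edge v y] in vU2.
have [N3|N2] := ltnP 2 #|N|.
  apply: (exch_boundary_pair Ba Bb vU); apply: leq_trans N3 _; apply: subset_leq_card.
  by apply/subsetP=> z; rewrite !inE => /andP[-> ->]; rewrite !orbT.
have /card_gt0P[w] : 0 < #|[set y | edge v y] :\: N|.
  rewrite cardsD subn_gt0; apply: leq_ltn_trans dv; apply: leq_trans N2.
  exact/subset_leq_card/subsetIr.
rewrite !inE => /andP[+ vw]; rewrite vw andbT => wU.
have Bw : boundary w by split => //; exists v.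
have E c : boundary c -> exch U c w.
  move=> Bc; apply: (exch_boundary_pair Bc Bw vU).
  apply: (@leq_trans #|w |: N|); first by rewrite cardsU1 !inE (negPf wU).
  apply/subset_leq_card/subsetP=> z; rewrite !inE.
  by case/orP=> [/eqP ->|/andP[-> ->]]; rewrite ?eqxx ?vw !orbT.
exact: exch_trans cU (E a Ba) (exch_sym (E b Bb)).
Qed.

(* The case left open by exch_boundary_branch.                                *)
Hypothesis thin : forall v, v \in U -> 1 < #|[set y in U | edge v y]| -> degree v <= 2.

Lemma thin_nbr v u1 u2 z :
  v \in U -> u1 \in U -> u2 \in U -> u1 != u2 -> edge v u1 -> edge v u2 ->
  edge v z -> z = u1 \/ z = u2.
Proof.
move=> vU u1U u2U u12 v1 v2 vz.
have s1 : [set u1; u2] \subset [set y in U | edge v y].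
  by apply/subsetP=> y; rewrite !inE => /orP[] /eqP ->; apply/andP.
have dv : degree v <= 2.
  by apply: thin => //; apply: leq_trans (subset_leq_card s1); rewrite cards2 u12.
have : [set u1; u2] == [set y | edge v y].
  rewrite eqEcard cards2 u12 [_ <= _]dv andbT; apply: subset_trans s1 _.
  by apply/subsetP=> y; rewrite !inE => /andP[].
by move/eqP/setP/(_ z); rewrite !inE vz => /orP[] /eqP; [left|right].
Qed.

(** A longest path inside [U] covers [U]. Otherwise an edge of [U] leaves it, either at an end,
    where the path could be prolonged, or at an inner vertex, which would then have a third
    neighbour. *)
Lemma thin_path :
  0 < #|U| -> exists s : seq X,
  [/\ uniq s, s =i U & forall x i, i.+1 < size s -> edge (nth x s i) (nth x s i.+1)].
Proof.
case/card_gt0P=> x0 x0U.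
pose P n := [exists t : n.-tuple X, [&& sorted (@edge X) t, uniq t & all [in U] t]].
have P1 : exists n, P n by exists 1; apply/existsP; exists [tuple x0]; rewrite /= x0U.
have Pm n : P n -> n <= #|X|.
  case/existsP=> t /and3P[_ ut _]; rewrite -(size_tuple t) -(card_uniqP ut).
  exact: max_card.
have mem_P s : sorted (@edge X) s -> uniq s -> all [in U] s -> P (size s).
  by move=> e u a; apply/existsP; exists (in_tuple s); rewrite /= e u a.
have [n /existsP[t /and3P[st ut at_]] nmax] := ex_maxnP P1 Pm.
have sz := size_tuple t; exists t; split => //; last first.
  by move=> x; apply/sortedP.
move=> y; apply/idP/idP => [|yU]; first exact: (allP at_).
apply/negPn/negP => yt.
have n0 : 0 < n.
  by apply: (nmax 1); apply/existsP; exists [tuple x0]; rewrite /= x0U.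
move: st ut at_ sz yt; move: (tval t) => s; case: s n0 => [|x p] n0 st ut aU sz yt.
  by rewrite -sz in n0.
have xU : x \in U by case/andP: aU.
have [z [z' [/and3P[zz' zU z'U] zs z's]]] :=
  connect_crossing (cU xU yU) (mem_head x p) yt.
have z'N : z' \notin x :: p := z's.
have [zx|zx] := eqVneq z x.
  have : P (size [:: z', x & p]).
    apply: mem_P; last by rewrite /= z'U.
      by rewrite /= edge_sym -zx zz' zx.
    by rewrite cons_uniq z'N.
  by move/nmax; rewrite -sz /= ltnn.
have zp : z \in p by have : z \in x :: p := zs; rewrite inE (negPf zx).
case/splitPr: zp st ut aU sz z'N {zs yt z's} => p1 p2 st ut aU sz z'N.
case: p2 st ut aU sz z'N => [|w p2] st ut aU sz z'N.
  have : P (size (rcons (x :: p1 ++ [:: z]) z')).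
    apply: mem_P; last by rewrite all_rcons /= z'U.
      rewrite /= rcons_path; apply/andP; split; first exact: st.
      by rewrite last_cat.
    by rewrite rcons_uniq z'N.
  by move/nmax; rewrite size_rcons -sz ltnn.
have lz : edge z (last x p1).
  by move: st; rewrite /= cat_path /= edge_sym => /and3P[_ ->].
have zw : edge z w by move: st; rewrite /= cat_path /= => /and4P[_ _ ->].
have lU : last x p1 \in U.
  by apply: (allP aU); rewrite -[x :: _]/((x :: p1) ++ _) mem_cat mem_last.
have wU : w \in U by apply: (allP aU); rewrite !(inE, mem_cat) eqxx !orbT.
have lw : last x p1 != w.
  apply: contraTneq ut => lw; rewrite -[x :: _]/((x :: p1) ++ _) cat_uniq.
  suff -> : has [in x :: p1] [:: z, w & p2] by rewrite andbF.
  by apply/hasP; exists w; rewrite ?inE ?eqxx ?orbT //= -lw; exact: mem_last.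
case: (thin_nbr zU lU wU lw lz zw zz') => e; case/negP: z'N; rewrite e.
  by rewrite -[x :: _]/((x :: p1) ++ _) mem_cat mem_last.
by rewrite !(inE, mem_cat) eqxx !orbT.
Qed.

End Boundary.

(** * Blanks forming a path: chords and bridges *)

Section ThinPath.
Variables (X : sgraph) (U : {set X}) (s : seq X) (m : nat) (o : X).
Hypothesis cX : connected X.
Hypothesis thin : forall v, v \in U -> 1 < #|[set y in U | edge v y]| -> degree v <= 2.
Hypothesis us : uniq s.
Hypothesis sU : s =i U.
Hypothesis ss : size s = m.+2.
Hypothesis es : forall i, i.+1 < size s -> edge (nth o s i) (nth o s i.+1).
Hypothesis Bo : boundary U o.
Implicit Types (a b c u v w x y z : X).

Local Notation n i := (nth o s i).

Lemma nthU i : i < m.+2 -> n i \in U.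
Proof. by move=> lt; rewrite -sU mem_nth // ss. Qed.

Lemma nth_s_eq i j : i < m.+2 -> j < m.+2 -> (n i == n j) = (i == j).
Proof. by move=> li lj; rewrite nth_uniq // ss. Qed.

Lemma indexU v : v \in U -> index v s < m.+2 /\ n (index v s) = v.
Proof. by rewrite -sU => vs; rewrite -ss index_mem nth_index. Qed.

Lemma inner_nbr i z : 0 < i < m.+1 -> edge (n i) z -> z = n i.-1 \/ z = n i.+1.
Proof.
case: i => // i /andP[_ im] iz.
have im2 : i.+1 < m.+2 by rewrite ltnW.
have im1 : i < m.+2 by rewrite ltnW.
have im3 : i.+2 < m.+2 by [].
apply: (thin_nbr thin (nthU im2)) => //; rewrite ?nthU //=.
- by rewrite nth_s_eq // neq_ltn ltnW ?orbT.
- by rewrite edge_sym es ?ss.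
- by rewrite es ?ss.
Qed.

Lemma inner_degree i : 0 < i < m.+1 -> degree (n i) = 2.
Proof.
move=> im; have e : [set y | edge (n i) y] = [set n i.-1; n i.+1].
  apply/setP=> z; rewrite !inE; apply/idP/orP=> [/(inner_nbr im)[] ->|]; rewrite ?eqxx; auto.
  case: i im => // i /andP[_ im] [] /eqP -> /=.
    by rewrite edge_sym es // ss ltnW.
  by rewrite es // ss.
case: i im e => // i /andP[_ im] e.
have im1 : i < m.+2 by rewrite ltnW // ltnW.
by rewrite /degree e cards2 nth_s_eq //= neq_ltn leqnSn.
Qed.

Lemma inner_nbrU i z : 0 < i < m.+1 -> edge (n i) z -> z \in U.
Proof.
move=> im /(inner_nbr im); case: i im => // i /andP[_ im].
by case=> ->; apply: nthU; rewrite //= ltnW // ltnW.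
Qed.

Lemma index_cases i : i < m.+2 -> [\/ i = 0, i = m.+1 | 0 < i < m.+1].
Proof.
case: i => [|i]; first by constructor.
by rewrite ltnS leq_eqVlt => /orP[/eqP ->|->]; [constructor 2|constructor 3].
Qed.

Lemma outer_end u z : u \in U -> z \notin U -> edge u z -> u = n 0 \/ u = n m.+1.
Proof.
move=> uU zU uz; have [lt e] := indexU uU.
case: (index_cases lt) => [i0|im|i].
- by left; rewrite -e i0.
- by right; rewrite -e im.
by rewrite -e in uz; rewrite (inner_nbrU i uz) in zU.
Qed.

Lemma boundary_end c : boundary U c -> edge (n 0) c \/ edge (n m.+1) c.
Proof.
by case=> cN [u uU uc]; case: (outer_end uU cN uc) => <-; auto.
Qed.

(** Inner vertices have no further neighbours, so a chord would join the two ends. Then the end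
    adjacent to the boundary vertex [o] would have two neighbours in [U] and a third one outside,
    contrary to [thin]. *)
Lemma path_chordless i j : i < j -> j < m.+2 -> edge (n i) (n j) -> j = i.+1.
Proof.
move=> ij jm ijE; have im := ltn_trans ij jm.
have inner_case k l : 0 < k < m.+1 -> l < m.+2 -> edge (n k) (n l) ->
    l = k.-1 \/ l = k.+1.
  move=> kin lm; case: k kin => // k /andP[_ km] /(inner_nbr (i := k.+1) km)[] /eqP.
    by rewrite nth_s_eq ?(leqW (ltnW km)) // => /eqP ->; left.
  by rewrite nth_s_eq // => /eqP ->; right.
case: (index_cases im) => [i0|im1|iin].
- case: (index_cases jm) => [j0|jm1|jin]; first by rewrite j0 in ij.
    case: (posnP m) => m0; first by rewrite i0 jm1 m0.
    have m01 : n m != n 0 by rewrite nth_s_eq // -?lt0n // ltnW.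
    have m11 : n 1 != n m.+1 by rewrite nth_s_eq // eqSS eq_sym -lt0n.
    have [oU _] := Bo; case: (boundary_end Bo) => oE; move: ijE; rewrite i0 jm1 => ijE.
      case: (thin_nbr thin (nthU _) (nthU _) (nthU _) m11 _ ijE oE) => //.
      - by rewrite es ?ss.
      - by move=> e; rewrite e nthU in oU.
      - by move=> e; rewrite e nthU in oU.
    rewrite edge_sym in ijE.
    case: (thin_nbr thin (nthU _) (nthU _) (nthU _) m01 _ ijE oE) => // [|e|e].
    - by rewrite edge_sym es ?ss.
    - by rewrite e nthU // ltnW in oU.
    - by rewrite e nthU in oU.
  rewrite edge_sym in ijE; case: (inner_case _ _ jin im ijE) => e.
    by rewrite e prednK // (leq_ltn_trans _ ij).
  by move: ij; rewrite e ltnNge leqnSn.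
- by move: ij; rewrite im1 ltnNge -ltnS jm.
case: (inner_case _ _ iin jm ijE) => // e.
by move: ij; rewrite e ltnNge leq_pred.
Qed.

(** The edges available for returning from one end of the blank path to the other without running
    along it. *)
Definition outer : rel X := [rel x y | edge x y && ~~ ((x \in U) && (y \in U))].

Lemma outer_sym : symmetric outer.
Proof. by move=> x y; rewrite /outer /= edge_sym [(x \in U) && _]andbC. Qed.

Lemma outer_endL u z : outer u z -> u \in U -> u = n 0 \/ u = n m.+1.
Proof. by case/andP=> uz zU uU; rewrite uU in zU; apply: outer_end uU zU uz. Qed.

Lemma path_bridge :
  ~~ connect outer (n 0) (n m.+1) -> degree (n 0) != 1 -> degree (n m.+1) != 1 ->
  bridge s.
Proof.
move=> nc d0 d1.
(* [Z] is the side of [n 0]: what outer edges reach from [n 0], together with the first [i.+1] path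
   vertices. As the far end is not reached, [Z] meets [U] in those path vertices only. *)
have cut i : i < m.+1 -> cut_edge (n i) (n i.+1).
  move=> im; pose Z z := connect outer (n 0) z || (z \in U) && (index z s <= i).
  have idx j : j < m.+2 -> index (n j) s = j by move=> jm; rewrite index_uniq // ss.
  have ZU z : z \in U -> Z z -> index z s <= i.
    move=> zU /orP[cz|/andP[_ //]].
    have [-> //|z0] := eqVneq z (n 0); first by rewrite idx.
    have z0' : ~~ pred1 z (n 0) by rewrite /= eq_sym.
    have cz' : connect outer z (n 0) by rewrite (sym_connect_sym outer_sym).
    have [y [y' [yy' /eqP yz _]]] := connect_crossing cz' (eqxx z : pred1 z z) z0'.
    rewrite yz in yy'; case: (outer_endL yy' zU) => e; first by rewrite e eqxx in z0.
    by rewrite e (negPf nc) in cz.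
  apply: (@cut_edge_of_closed _ Z) => //.
  - by rewrite es ?ss.
  - by rewrite /Z nthU ?idx ?leqnn ?orbT // ltnW.
  - apply/negP=> /ZU; rewrite idx // ltnn nthU // => /(_ isT) //.
  move=> u v /andP[uv uvN] Zu.
  case: (boolP ((u \in U) && (v \in U))) => [/andP[uU vU]|uvU]; last first.
    have ouv : outer u v by apply/andP.
    case/orP: Zu => [cu|/andP[uU ui]].
      by apply/orP; left; apply: connect_trans cu (connect1 ouv).
    have e : u = n 0.
      case: (outer_endL ouv uU) => // e.
      by move: ui; rewrite e idx // leqNgt im.
    by apply/orP; left; rewrite -e; apply: connect1.
  apply/orP; right; rewrite vU /=.
  have ui := ZU _ uU Zu; have [um ue] := indexU uU; have [vm ve] := indexU vU.
  rewrite leqNgt; apply/negP => vi.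
  have e : index v s = (index u s).+1.
    by apply: path_chordless; rewrite ?ue ?ve // (leq_ltn_trans ui).
  have ei : index u s = i by apply/eqP; rewrite eqn_leq ui -ltnS -e.
  by case/negP: uvN; rewrite -ue -ve e ei.
case: s ss us cut d0 d1 (@inner_degree) => [//|x [//|y p]] [sp] up cut d0 d1 ideg.
apply/and5P; split=> //.
- apply/(pathP o) => i lt; apply: (cut i); by move: lt; rewrite /= sp.
- apply/allP => z zb; rewrite /= in zb.
  have zyp : z \in y :: p by apply: mem_belast zb.
  have zl : z != last y p.
    apply: contraTneq up => zl; rewrite lastI rcons_uniq negb_and negbK.
    have -> : last x (y :: p) = z by rewrite zl.
    by rewrite /= inE zb orbT.
  have [i lt ez] := nthP o zyp; rewrite -ez.
  have := ideg i.+1; rewrite /= => -> //.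
  rewrite ltnS -sp ltn_neqAle -ltnS lt andbT.
  apply: contraNneq zl => ei; rewrite -ez ei.
  by rewrite (last_nth o).
- by move: d1; rewrite -[m.+1]/(m.+2.-1) -sp nth_last.
Qed.

End ThinPath.

(** * Closing the blank path to a chordless cycle *)

Section ThinCycle.
Variables (X : sgraph) (U : {set X}) (s : seq X) (m : nat) (o : X).
Hypothesis cX : connected X.
Hypothesis cU : set_connected U.
Hypothesis thin : forall v, v \in U -> 1 < #|[set y in U | edge v y]| -> degree v <= 2.
Hypothesis us : uniq s.
Hypothesis sU : s =i U.
Hypothesis ss : size s = m.+2.
Hypothesis es : forall i, i.+1 < size s -> edge (nth o s i) (nth o s i.+1).
Hypothesis Bo : boundary U o.
Implicit Types (a b c u v w z : X).

Local Notation n i := (nth o s i).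
Local Notation x := (n 0).
Local Notation y := (n m.+1).

Let nU i : i < m.+2 -> n i \in U.
Proof. exact: nthU. Qed.
Let xU : x \in U.
Proof. exact: nU. Qed.
Let yU : y \in U.
Proof. exact: nU. Qed.

(** A shortest outer path from [y] back to [x] closes [s] up. Edges inside [U] join consecutive
    vertices by [path_chordless]. Any other edge between cycle vertices has both ends on the return
    path, where the distance [d] to [x] identifies vertices and changes by at most one along an
    outer edge. *)
Lemma chordless_closure :
  connect (outer U) x y ->
  exists q, [/\ uniq (s ++ q), path.cycle (@edge X) (s ++ q), 0 < size q
    & forall u v, u \in s ++ q -> v \in s ++ q -> edge u v ->
        next (s ++ q) u = v \/ next (s ++ q) v = u].
Proof.
have sO := sym_connect_sym (@outer_sym X U).
have yx : y != x by rewrite (nth_s_eq o us ss).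
rewrite sO => cyx; have [d [d0 dS dP]] := distance_exists (outer U) x.
pose r u v := outer U u v && (d u == (d v).+1).
have desc k z : d z = k -> connect (outer U) z x ->
    exists c : seq X, path r z c /\ last z c = x.
  elim: k z => [|k IH] z dz cz.
    have [->|zx] := eqVneq z x; first by exists [::].
    by have [z' [_ _]] := dP z cz zx; rewrite dz.
  have [zx|zx] := eqVneq z x; first by rewrite zx d0 in dz.
  have [z' [zz' cz' e]] := dP z cz zx.
  have [|c [pc lc]] := IH z' _ cz'; first by apply: succn_inj; rewrite -e.
  by exists (z' :: c); rewrite /= /r zz' e eqxx.
have [c [pc lc]] := desc _ y erefl cyx.
case: (lastP c) pc lc => [_ /= yx'|q x']; first by rewrite yx' eqxx in yx.
rewrite last_rcons => pc ex'; rewrite {}ex' in pc.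
pose C := y :: rcons q x.
pose gd : rel X := fun u v => d v < d u.
have gdt : transitive gd by move=> u v w h1 h2; apply: ltn_trans h2 h1.
have gdi : irreflexive gd by move=> u; rewrite /gd ltnn.
have sC : sorted gd C.
  by apply: sub_path pc => u v /andP[_ /eqP e]; rewrite /gd e.
have uC : uniq C := sorted_uniq gdt gdi sC.
have qN z : z \in q -> z \notin s.
  move=> zq; apply/negP; rewrite sU => zU.
  have [w ow] : exists w, outer U w z.
    have zqx : z \in rcons q x by rewrite mem_rcons inE zq orbT.
    case/splitPr: zqx pc => p1 p2; rewrite cat_path /= => /and3P[_ /andP[h _] _].
    by exists (last y p1).
  rewrite outer_sym in ow; have := outer_endL thin us sU ss es ow zU.
  move: uC; rewrite /C /= mem_rcons rcons_uniq inE => /and3P[+ xq _].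
  rewrite negb_or => /andP[_ yq].
  by case=> e; rewrite e in zq; [rewrite zq in xq|rewrite zq in yq].
have uD : uniq (s ++ q).
  rewrite cat_uniq us /=; apply/andP; split; first by apply/hasPn => z /qN.
  by move: uC => /= /andP[_]; rewrite rcons_uniq => /andP[].
have q0 : 0 < size q.
  rewrite lt0n size_eq0; apply: contraTneq pc => -> /=.
  by rewrite /r /outer /= xU yU andbF.
have [p sE] : exists p, s = x :: p by move: ss; case: (s) => // z p _; exists p.
have lp : last x p = y by rewrite (last_nth o) -sE; move: ss; rewrite sE /= => -[->].
have cD : path.cycle (@edge X) (s ++ q).
  rewrite sE /= rcons_cat cat_path lp; apply/andP; split.
    by apply/(pathP o) => i lt; have := es (i := i); rewrite sE /=; apply.
  by apply: sub_path pc => u v /andP[/andP[]].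
exists q; split => //.
have [t' tE] : exists t', belast x p = x :: t'.
  by move: ss; rewrite sE; case: (p) => // z p' _; exists (belast z p').
(* Rotating the cycle makes the return path [C] a prefix, so that [next] can be read off from
   positions in [C]. *)
have rD : rot (size (belast x p)) (s ++ q) = C ++ t'.
  have -> : s ++ q = rcons (belast x p) y ++ q by rewrite -lp -lastI -sE.
  by rewrite cat_rcons rot_size_cat tE /C /= cat_rcons.
have uD' : uniq (C ++ t') by rewrite -rD rot_uniq.
have nC i : i.+1 < size C -> next (s ++ q) (nth o C i) = nth o C i.+1.
  move=> lt; rewrite -(next_rot (size (belast x p)) uD) rD.
  have := @next_nth_lt _ o (C ++ t') i uD'; rewrite !nth_cat lt (ltnW lt); apply.
  by rewrite size_cat; apply: leq_trans lt (leq_addr _ _).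
have dC i : i.+1 < size C -> d (nth o C i) = (d (nth o C i.+1)).+1.
  by move=> lt; have /(pathP o)/(_ i lt)/andP[_ /eqP] := pc.
have dI u v : u \in C -> v \in C -> d u = d v -> u = v.
  move=> uin vin e; rewrite -(nth_index o uin) -(nth_index o vin).
  have hlt := sorted_ltn_nth gdt o sC.
  case: (ltngtP (index u C) (index v C)) => [lt|lt|-> //].
    have := hlt _ _ _ _ lt; rewrite !inE !index_mem => /(_ uin vin).
    by rewrite /gd !nth_index // e ltnn.
  have := hlt _ _ _ _ lt; rewrite !inE !index_mem => /(_ vin uin).
  by rewrite /gd !nth_index // e ltnn.
have step u v : u \in C -> v \in C -> d u = (d v).+1 -> next (s ++ q) u = v.
  move=> uin vin e; have lt : index u C < size C by rewrite index_mem.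
  have ux : u != x by apply: contra_eq_neq e => ->; rewrite d0.
  have lt' : (index u C).+1 < size C.
    rewrite ltn_neqAle lt andbT; apply: contraNneq ux => ei.
    rewrite -(nth_index o uin) -[index u C]/((index u C).+1.-1) ei nth_last /=.
    by rewrite last_rcons.
  have h := nC _ lt'; have h' := dC _ lt'; rewrite nth_index // in h h'.
  by rewrite h; apply: dI; rewrite ?mem_nth //; apply: succn_inj; rewrite -h'.
move=> u v uD1 vD1 uv.
have [uvU|uvU] := boolP ((u \in U) && (v \in U)).
  case/andP: uvU => uU vU.
  have [um ue] := indexU o sU ss uU; have [vm ve] := indexU o sU ss vU.
  have cons i : i.+1 < m.+2 -> next (s ++ q) (n i) = n i.+1.
    move=> lt; have := @next_nth_lt _ o (s ++ q) i uD.
    rewrite !nth_cat ss lt (ltnW lt); apply.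
    by rewrite size_cat ss; apply: leq_trans lt (leq_addr _ _).
  have chord i j := @path_chordless _ _ _ _ _ thin us sU ss es Bo i j.
  case: (ltngtP (index u s) (index v s)) => [lt|lt|e].
  - left; have e := chord _ _ lt vm; rewrite ue ve in e.
    by rewrite -ue -ve (e uv) cons // -(e uv).
  - right; have e := chord _ _ lt um; rewrite ue ve edge_sym in e.
    by rewrite -ue -ve (e uv) cons // -(e uv).
  - by move: uv; rewrite -ue -ve e edge_irr.
have inC w w' : w \in s ++ q -> outer U w w' -> w \in C.
  rewrite mem_cat => /orP[ws|wq] ow; last by rewrite inE mem_rcons inE wq !orbT.
  rewrite sU in ws; case: (outer_endL thin us sU ss es ow ws) => ->.
    by rewrite inE mem_rcons mem_head orbT.
  exact: mem_head.
have ouv : outer U u v by apply/andP.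
have ovu : outer U v u by rewrite outer_sym.
have uin := inC _ _ uD1 ouv; have vin := inC _ _ vD1 ovu.
have := dS _ _ ouv; have := dS _ _ ovu.
rewrite leq_eqVlt ltnS => /orP[/eqP e _|l1]; first by right; apply: step.
rewrite leq_eqVlt ltnS => /orP[/eqP e|l2]; first by left; apply: step.
have e : u = v by apply: dI => //; apply/eqP; rewrite eqn_leq l1 l2.
by rewrite e edge_irr in uv.
Qed.

Hypothesis ncX : ~ is_cycle X.

(** Since [X] is not a cycle, some vertex of the closed path has a third neighbour, which lies off
    the closed path because there are no chords. *)
Lemma closure_branch q :
  uniq (s ++ q) -> path.cycle (@edge X) (s ++ q) -> 0 < size q ->
  (forall u v, u \in s ++ q -> v \in s ++ q -> edge u v ->
        next (s ++ q) u = v \/ next (s ++ q) v = u) ->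
  exists v w, [/\ v \in s ++ q, w \notin s ++ q & edge v w].
Proof.
move=> uD cD q0 ch; set D := s ++ q in uD cD ch *.
have sD : 2 < size D by rewrite size_cat ss -(prednK q0) addnS.
have [v vD dv] : exists2 v, v \in D & 2 < degree v.
  apply/exists_inP; apply: contra_notT ncX => /exists_inPn h.
  by apply: (@cycle_degree_le2 X D) => // v vD; rewrite leqNgt h.
exists v; have /card_gt0P[w] : 0 < #|[set z | edge v z] :\: [set next D v; prev D v]|.
  rewrite cardsD subn_gt0; apply: leq_ltn_trans dv.
  by apply: leq_trans (subset_leq_card (subsetIr _ _)) _; rewrite cards2; case: eqP.
rewrite !inE negb_or => /andP[/andP[wn wp] vw]; exists w; split => //.
apply/negP => wD; case: (ch v w vD wD vw) => e; first by rewrite e eqxx in wn.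
by rewrite -e prev_next // eqxx in wp.
Qed.

Lemma claw_start a b : boundary U a -> boundary U b -> edge x a -> edge x b -> exch U a b.
Proof.
move=> [aU _] [bU _] xa xb; have [->|ab] := eqVneq a b; first exact: exch_refl.
by apply: (@exch_claw _ _ x (n 1)) => //; [apply: nU|apply: es; rewrite ss].
Qed.

Lemma claw_end a b : boundary U a -> boundary U b -> edge y a -> edge y b -> exch U a b.
Proof.
move=> [aU _] [bU _] xa xb; have [->|ab] := eqVneq a b; first exact: exch_refl.
apply: (@exch_claw _ _ y (n m)) => //; first by apply: nU; rewrite ltnW.
by rewrite edge_sym es // ss.
Qed.

Lemma degree1_nbr u v w : degree u = 1 -> edge u v -> edge u w -> v = w.
Proof.
move=> /eqP/cards1P[z e] uv uw; have /setP h := e.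
by have := h v; have := h w; rewrite !inE uv uw => /esym/eqP -> /esym/eqP ->.
Qed.

(** If one end of the path is a leaf, all boundary tokens hang on the other end and claws there
    suffice. Otherwise, the path not being a bridge, it closes up to a cycle, which carries the
    tokens to a branch vertex. *)
Lemma exch_boundary_thin a b :
  ~ has_bridge X m.+2 -> boundary U a -> boundary U b -> exch U a b.
Proof.
move=> nb Ba Bb.
have bend c (Bc : boundary U c) := boundary_end thin us sU ss es Bc.
have [dx|dx] := eqVneq (degree x) 1.
  have yb c : boundary U c -> edge y c.
    move=> Bc; case: (bend c Bc) => // xc; have x1 : edge x (n 1) by apply: es; rewrite ss.
    by case: Bc => [cN _]; rewrite -(degree1_nbr dx x1 xc) nU in cN.
  by apply: claw_end => //; apply: yb.
have [dy|dy] := eqVneq (degree y) 1.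
  have xb c : boundary U c -> edge x c.
    move=> Bc; case: (bend c Bc) => // yc.
    have y1 : edge y (n m) by rewrite edge_sym; apply: es; rewrite ss.
    by case: Bc => [cN _]; rewrite -(degree1_nbr dy y1 yc) nU // ltnW in cN.
  by apply: claw_start => //; apply: xb.
have cxy : connect (outer U) x y.
  apply/negPn/negP => nc; apply: nb; exists s; split => //.
  exact: (path_bridge cX thin us sU ss es Bo).
have [q [uD cD q0 ch]] := chordless_closure cxy.
have [v [w [vD wD vw]]] := closure_branch uD cD q0 ch.
set D := s ++ q in uD cD vD wD.
have wU : w \notin U by apply: contra wD; rewrite mem_cat sU => ->.
have qU z : z \in q -> z \notin U.
  move=> zq; rewrite -sU; apply: contraL zq => zs.
  by move: uD; rewrite cat_uniq => /and3P[_ /hasPn h _]; apply: contraL zs => /h.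
have nn i : i.+1 < size D -> next D (nth o D i) = nth o D i.+1.
  by move=> lt; apply: next_nth_lt.
have sD : m.+2 < size D by rewrite size_cat ss -addn1 leq_add2l.
have nD i : i < m.+2 -> nth o D i = n i by move=> lt; rewrite nth_cat ss lt.
have xD : x \in D by rewrite mem_cat sU xU.
have yD : y \in D by rewrite mem_cat sU yU.
have y1 : y = next D (n m).
  by rewrite -[n m]nD ?leqnSn // nn ?nD // ltnW.
have x1 : n 1 = next D x by rewrite -[x]nD // nn ?nD // (leq_trans _ sD).
have bq : next D y \in q.
  by rewrite -[y]nD // nn // nth_cat ss ltnn subnn mem_nth.
have aq : prev D x \in q.
  rewrite /D; have [p sE] : exists p, s = x :: p by move: ss; case: (s) => // z p _; exists p.
  have -> : s ++ q = x :: (p ++ q) by rewrite {1}sE.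
  have /andP[xN _] : uniq (x :: (p ++ q)) by rewrite -cat_cons -sE.
  rewrite prev_nth mem_head memNindex // -last_nth last_cat.
  by case: (q) q0 => // z q' _; rewrite /= mem_last.
have Ea : exch U (prev D x) w.
  apply: (@exch_gap _ D U v w x (n 1)) => //; rewrite ?nU ?qU //.
  by right; rewrite next_prev.
have Eb : exch U (next D y) w.
  apply: (@exch_gap _ D U v w y (n m)) => //; rewrite ?qU //; last by left.
  by apply: nU; rewrite ltnW.
have Bb0 : boundary U (next D y).
  by split; [apply: qU|exists y => //; apply: next_cycle].
have Ba0 : boundary U (prev D x).
  by split; [apply: qU|exists x => //; rewrite edge_sym; apply: prev_cycle].
(* Boundary tokens at one end are exchanged by a claw with the cycle neighbour of that end, and both
   such neighbours are exchanged with [w] by rotation. *)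
have E c : boundary U c -> exch U c w.
  move=> Bc; case: (bend c Bc) => [xc|yc].
    apply: exch_trans cU _ Ea; apply: claw_start => //.
    by rewrite edge_sym; apply: prev_cycle.
  by apply: exch_trans cU _ Eb; apply: claw_end => //; apply: next_cycle.
exact: exch_trans cU (E a Ba) (exch_sym (E b Bb)).
Qed.

End ThinCycle.

Lemma exch_boundary (X : sgraph) (U : {set X}) a b :
  connected X -> ~ is_cycle X -> ~ has_bridge X #|U| -> 1 < #|U| ->
  set_connected U -> boundary U a -> boundary U b -> exch U a b.
Proof.
move=> cX ncX nb U1 cU Ba Bb.
have [/exists_inP[v vU /andP[h1 h2]]|/exists_inPn h] :=
  boolP [exists (v | v \in U), (1 < #|[set y in U | edge v y]|) && (2 < degree v)].
  exact: (exch_boundary_branch cU Ba Bb vU).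
have thin v : v \in U -> 1 < #|[set y in U | edge v y]| -> degree v <= 2.
  by move=> vU v1; have := h v vU; rewrite v1 /= -leqNgt.
have [s [us sU es]] := thin_path cU thin (ltnW U1).
have ss : size s = #|U| by rewrite -(card_uniqP us); apply: eq_card.
have sz : size s = (size s).-2.+2 by move: U1; rewrite -ss; case: size => [|[]].
apply: (exch_boundary_thin cX cU thin us sU sz (es a) Ba ncX _ Ba Bb).
by rewrite -sz ss.
Qed.

(** * All tokens *)

Section Propagation.
Variable X : sgraph.
Implicit Types (U H : {set X}) (a b c u v w x y z h : X).

(** The token at [h] is the only one inside the connected set [H], so it can be walked to [h'] while
    [z] stays put. *)
Lemma exch_pull H h h' z :
  set_connected H -> h \in H -> h' \in H -> z \notin H ->
  exch (H :\ h) h z -> exch (H :\ h') h' z.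
Proof.
move=> cH hH h'H zH; case/connectP: (cH h h' hH h'H) => p.
elim: p h {hH} => [|h1 p IH] h /=; first by move=> _ ->.
case/andP=> /and3P[hh1 hH h1H] pth lst E; apply: IH pth lst _.
have h1h : h1 != h by apply: contraTneq hh1 => ->; rewrite edge_irr.
have := @exch_slide X (H :\ h) h1 h z; rewrite edge_sym hh1 !inE h1h h1H eqxx (negPf zH) andbF /=.
have -> : z != h by apply: contraNneq zH => ->.
suff -> : h |: (H :\ h) :\ h1 = H :\ h1 by apply.
apply/setP=> y; rewrite !inE; case: (eqVneq y h) => [->|] /=; last by [].
by rewrite eq_sym h1h hH.
Qed.

(** Take [u] farthest from [c]: the other vertices descend to [c] by decreasing distance and never
    meet [u]. *)
Lemma set_connected_remove H c :
  set_connected H -> c \in H -> 1 < #|H| ->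
  exists u, [/\ u \in H, u != c, set_connected (H :\ u)
              & exists2 w, w \in H :\ u & edge w u].
Proof.
move=> cH cin H1; have [d [d0 _ dP]] := rank_exists cH cin.
have [u uH um] := @arg_maxnP _ c [in H] d cin.
have uc : u != c.
  have /card_gt0P[w] : 0 < #|H :\ c|.
    by move: H1; rewrite (cardsD1 c) cin.
  rewrite !inE => /andP[wc wH]; apply: contraTneq (um w wH) => ->.
  by have [y [_ e]] := dP w wH wc; rewrite d0 e.
have desc x : x \in H -> x != c -> exists y, [/\ edge x y, y \in H :\ u & d y < d x].
  move=> xH xc; have [y [/and3P[xy _ yH] e]] := dP x xH xc.
  exists y; split => //; last by rewrite e.
  rewrite !inE yH andbT; apply: contraTneq (um x xH) => <-.
  by rewrite e -ltnNge.
exists u; split => //; last first.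
  by have [y [uy yH _]] := desc u uH uc; exists y; rewrite // edge_sym.
apply: (@set_connected_from _ _ c) => x; have [k] := ubnP (d x).
elim: k x => // k IH x; rewrite ltnS => dx xHu.
have [->|xc] := eqVneq x c; first exact: connect0.
have xH : x \in H by move: xHu; rewrite !inE => /andP[].
have [y [xy yH yx]] := desc x xH xc.
apply: connect_trans (IH y _ yH); last exact: leq_trans yx dx.
by apply: connect1; apply/and3P.
Qed.

Section All.
Variable K : nat.
Hypothesis cX : connected X.
Hypothesis ncX : ~ is_cycle X.
Hypothesis nbX : ~ has_bridge X K.
Hypothesis K1 : 1 < K.

(** Induction along a path to [z]. When it leaves [U] at [c], the blanks shift to contain [c] and
    vacate some [u']. The token now at [u'] is next to the blanks, hence exchangeable with the
    boundary token given by induction; [exch_pull] then brings it back to [c]. *)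
Lemma exch_some_boundary p U u z :
  #|U| = K -> set_connected U -> u \in U -> path (@edge X) u p -> last u p = z ->
  z \notin U -> exists2 c, boundary U c & exch U c z.
Proof.
elim: p U u => [|c p IH] U u UK cU uU /=; first by move=> _ <-; rewrite uU.
case/andP=> uc cp lz zU; have [cinU|cU'] := boolP (c \in U); first exact: (IH U c).
have Bc : boundary U c by split => //; exists u.
have [zc|zc] := eqVneq z c.
  by exists c => //; rewrite zc; apply: exch_refl.
pose H := c |: U; have cH : set_connected H by apply: set_connected_add uc.
have cinH : c \in H by rewrite setU11.
have HK : #|H| = K.+1 by rewrite cardsU1 cU' UK.
have [|u' [u'H u'c cU1 [w wU1 wu']]] := set_connected_remove cH cinH.
  by rewrite HK ltnW.
have U1K : #|H :\ u'| = K.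
  by move: (cardsD1 u' H); rewrite u'H HK => -[].
have zH : z \notin H by rewrite !inE negb_or zc.
have [||c' Bc' E] := IH (H :\ u') c U1K cU1 _ cp lz.
- by rewrite !inE eq_sym u'c eqxx.
- by rewrite !inE negb_and (negPf zU) (negPf zc) orbT.
have Bu' : boundary (H :\ u') u' by split; [rewrite !inE eqxx|exists w].
have E1 : exch (H :\ u') u' c'.
  by apply: exch_boundary => //; rewrite U1K.
have := exch_pull cH u'H cinH zH (exch_trans cU1 E1 E).
have -> : H :\ c = U; last by exists c.
by apply/setP=> y; rewrite !inE; case: eqP => //= ->; rewrite (negPf cU').
Qed.

Lemma exch_all U a b :
  #|U| = K -> set_connected U -> a \notin U -> b \notin U -> exch U a b.
Proof.
move=> UK cU aU bU; have /card_gt0P[u uU] : 0 < #|U| by rewrite UK ltnW.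
have toB z : z \notin U -> exists2 c, boundary U c & exch U c z.
  move=> zU; case/connectP: (cX.2 u z) => p pth lz.
  exact: exch_some_boundary uU pth (esym lz) zU.
have [c Bc Ec] := toB a aU; have [c' Bc' Ec'] := toB b bU.
apply: (exch_trans cU (exch_sym Ec)); apply: (exch_trans cU _ Ec').
by apply: exch_boundary => //; rewrite UK.
Qed.
End All.

Lemma connected_set_exists K :
  connected X -> 0 < K <= #|X| -> exists2 U : {set X}, #|U| = K & set_connected U.
Proof.
move=> cX; case: K => // K /= KX.
have cT : set_connected [set: X].
  move=> x y _ _; apply: connect_sub (cX.2 x y) => u v uv.
  by apply: connect1; apply/and3P; rewrite uv !inE.
have : exists2 U : {set X}, #|U| = #|X| - 0 & set_connected U.
  by exists setT => //; rewrite cardsT subn0.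
have -> : K.+1 = #|X| - (#|X| - K.+1) by rewrite subKn.
have : #|X| - K.+1 < #|X| by rewrite ltn_subrL (leq_trans _ KX).
elim: (#|X| - K.+1) => // j IH jX h0.
have [U Uj cU] := IH (ltnW jX) h0.
have U1 : 1 < #|U| by rewrite Uj ltn_subRL addn1.
have /card_gt0P[c cin] : 0 < #|U| by apply: ltnW.
have [u [uU _ cU' _]] := set_connected_remove cU cin U1.
exists (U :\ u) => //; have := cardsD1 u U; rewrite uU Uj add1n => e.
by rewrite subnS e.
Qed.

Lemma exch_two a b :
  connected X -> (exists v : X, 2 < degree v) -> a != b ->
  exch (~: [set a; b]) a b.
Proof.
move=> cX [v dv] ab.
have -> : ~: [set a; b] = setT :\ a :\ b.
  by apply/setP=> z; rewrite !inE negb_or andbT andbC.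
apply: (@exch_pair _ _ v) => //.
  move=> x y _ _; apply: connect_sub (cX.2 x y) => u w uw.
  by apply: connect1; apply/and3P; rewrite uw !inE.
by apply: leq_trans dv _; apply/subset_leq_card/subsetP => z; rewrite !inE.
Qed.

(** Not being a tree, [X] contains a cycle; without a vertex of degree at least 3 that cycle would
    be all of [X]. *)
Lemma branch_exists :
  connected X -> ~ is_cycle X -> ~ is_tree X -> exists v : X, 2 < degree v.
Proof.
move=> cX nc nt; apply/existsP; apply: contra_notT nt => /existsPn h; split => //.
move=> s /andP[cs us]; rewrite ltnNge; apply/negP => s3; apply: nc.
by apply: (cycle_degree_le2 cX cs us s3) => v _; rewrite leqNgt h.
Qed.
End Propagation.

Section Permutations.
Local Open Scope group_scope.

(** * Arrangements of the tokens as permutations *)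

(** A permutation preserving the fibres of [key] is a product of transpositions within fibres:
    composing with the transposition of a moved point [x] and its preimage [y] shrinks the
    support. *)
Lemma tperm_ind (T : finType) (K : eqType) (key : T -> K) (P : {perm T} -> Prop) :
  P 1 -> (forall x y g, key x = key y -> P g -> P (tperm x y * g)) ->
  forall g : {perm T}, (forall x, key (g x) = key x) -> P g.
Proof.
move=> P1 PM g; have [n] := ubnP #|[set x | g x != x]|.
elim: n g => // n IH g; rewrite ltnS => gn kg.
have [/forallP h|/forallPn[x gx]] := boolP [forall x, g x == x].
  by suff -> : g = 1 by []; apply/permP=> x; rewrite perm1 (eqP (h x)).
pose y := g^-1 x; have gy : g y = x by rewrite permKV.
have kxy : key x = key y by rewrite -gy kg.
have -> : g = tperm x y * (tperm x y * g) by rewrite mulgA tperm2 mul1g.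
apply: PM => //; apply: IH => [|z]; last first.
  by rewrite permM kg; case: tpermP => // ->.
apply: leq_trans gn; apply/proper_card/properP; split.
  apply/subsetP=> z; rewrite !inE permM; apply: contraNN => /eqP gz.
  rewrite tpermD ?gz //; first by apply: contraNneq gx => ->; rewrite gz.
  apply: contraNneq gx => yz. have -> : x = z by rewrite -gy yz.
  exact/eqP.
by exists x; rewrite !inE // permM tpermL gy eqxx.
Qed.

Lemma perm_transport (T : finType) (A B : {set T}) :
  #|A| = #|B| -> exists g : {perm T}, g @: A = B.
Proof.
have [n] := ubnP #|A :\: B|; elim: n A => // n IH A; rewrite ltnS => An AB.
have [AB0|] := posnP #|A :\: B|.
  exists 1; have -> : (1 : {perm T}) @: A = A.
    by rewrite -[RHS]imset_id; apply: eq_imset => z; rewrite perm1.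
  by apply/eqP; rewrite eqEcard AB leqnn andbT -setD_eq0 -cards_eq0 AB0.
move=> AB1; have /card_gt0P[b] : 0 < #|B :\: A|.
  by move: AB1; rewrite !cardsD setIC AB.
have /card_gt0P[a] := AB1; rewrite !inE => /andP[aB aA] /andP[bA bB].
have E : tperm a b @: A :\: B \subset (A :\: B) :\ a.
  apply/subsetP=> z /setDP[/imsetP[y yA ->]] => zB; move: zB; rewrite !inE.
  case: tpermP => [_|e|/eqP ya _]; rewrite ?bB //; first by rewrite -e yA in bA.
  by rewrite ya yA andbT.
have [||g gE] := IH (tperm a b @: A).
- apply: leq_trans An; apply: leq_ltn_trans (subset_leq_card E) _.
  by rewrite [X in _ < X](cardsD1 a) !inE aB aA.
- by rewrite card_imset //; apply: perm_inj.
exists (tperm a b * g); rewrite -gE -imset_comp.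
by apply: eq_imset => z; rewrite /= permM.
Qed.

Lemma tperm_chain (T : finType) (x y z : T) :
  x != y -> x != z -> tperm y z * tperm x y * tperm y z = tperm x z.
Proof.
move=> xy xz; have := tpermJ x y (tperm y z); rewrite tpermL tpermD 1?eq_sym // => <-.
by rewrite conjgE tpermV mulgA.
Qed.

Section States.
Variables (X : sgraph) (C : eqType) (col : X -> C).
Implicit Types (s g h k : {perm X}) (U : {set X}) (a b u v w x y z p q : X).

(** [s u] is the occupant of position [u], and [col] colours occupants. As products act left factor
    first, [tperm u v * s] exchanges the contents of positions [u] and [v]. *)
Definition swap_rel : rel {perm X} := [rel s s' : {perm X} |
  [exists u, exists v,
    [&& edge u v, col (s u) != col (s v) & s' == tperm u v * s]]].

Definition reach := connect swap_rel.

Lemma reach_swap s u v : edge u v -> col (s u) != col (s v) -> reach s (tperm u v * s).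
Proof.
move=> uv c; apply: connect1; apply/existsP; exists u; apply/existsP; exists v.
by rewrite uv c eqxx.
Qed.

Lemma swap_rel_sym : symmetric swap_rel.
Proof.
suff h s s' : swap_rel s s' -> swap_rel s' s by move=> s s'; apply/idP/idP; apply: h.
case/existsP=> u /existsP[v /and3P[uv c /eqP ->]].
apply/existsP; exists u; apply/existsP; exists v.
by rewrite uv !permM tpermL tpermR eq_sym c mulgA tperm2 mul1g eqxx.
Qed.

Lemma reach_sym s s' : reach s s' = reach s' s.
Proof. exact: sym_connect_sym swap_rel_sym s s'. Qed.

Lemma reach_trans s1 s2 s3 : reach s1 s2 -> reach s2 s3 -> reach s1 s3.
Proof. exact: connect_trans. Qed.

Definition colour_preserving g := forall z, col (g z) = col z.

Lemma colour_preserving1 : colour_preserving 1.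
Proof. by move=> z; rewrite perm1. Qed.

Lemma colour_preservingM g h :
  colour_preserving g -> colour_preserving h -> colour_preserving (g * h).
Proof. by move=> cg ch z; rewrite permM ch cg. Qed.

Lemma colour_preservingV g : colour_preserving g -> colour_preserving g^-1.
Proof. by move=> cg z; rewrite -[in RHS](permKV g z) cg. Qed.

Lemma colour_preserving_tperm x y : col x = col y -> colour_preserving (tperm x y).
Proof. by move=> xy z; case: tpermP => // ->. Qed.

Lemma reach_mulr g s s' : colour_preserving g -> reach s s' -> reach (s * g) (s' * g).
Proof.
move=> cg; case/connectP=> c; elim: c s => [s _ -> |s1 c IH s]; first exact: connect0.
move=> /= /andP[st pc] lc; apply: reach_trans (IH s1 pc lc).
case/existsP: st => u /existsP[v /and3P[uv cuv /eqP ->]].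
by rewrite -mulgA; apply: reach_swap; rewrite // !permM !cg.
Qed.

(** Edges of a connected set generate its symmetric group: [tperm_chain] builds any transposition
    along a path, and transpositions give the rest. *)
Lemma closed_under_edges U (Q : {perm X} -> {perm X} -> Prop) :
  (forall s, Q s s) -> (forall s s' s'', Q s s' -> Q s' s'' -> Q s s'') ->
  (forall s u v, induced U u v -> Q s (tperm u v * s)) ->
  set_connected U -> forall g s, (forall z, z \notin U -> g z = z) -> Q s (g * s).
Proof.
move=> Q1 QM QE cU; have QT u v s : u \in U -> v \in U -> Q s (tperm u v * s).
  move=> uU vU; case/connectP: (cU v u vU uU) => c.
  elim: c v {vU} s => [|w c IH] v s /=; first by move=> _ ->; rewrite tperm1 mul1g.
  case/andP=> vw pc lc; have [->|uv] := eqVneq u v; first by rewrite tperm1 mul1g.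
  have Qw s1 : Q s1 (tperm w v * s1) by apply: QE; rewrite induced_sym.
  have [->|uw] := eqVneq u w; first exact: Qw.
  rewrite -(tperm_chain uw uv) -!mulgA.
  by apply: (QM _ _ _ (Qw s)); apply: (QM _ _ _ (IH _ _ pc lc)); apply: Qw.
(* The fibres of [key] are [U] and the singletons outside it, so preserving [key] means fixing the
   complement of [U] pointwise. *)
pose key z := if z \in U then None else Some z.
suff h g : (forall z, key (g z) = key z) -> forall s, Q s (g * s).
  move=> g s gU; apply: h => z; rewrite /key.
  have [zU|zU] := boolP (z \in U); last by rewrite gU // (negPf zU).
  case: ifPn => // gzU; case/negP: (gzU); have := gU _ gzU => /perm_inj e.
  by rewrite e in gzU *.
move: g; apply: tperm_ind => [s|x y g kxy IH s]; first by rewrite mul1g.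
rewrite -mulgA; apply: (QM _ _ _ (IH s)); move: kxy; rewrite /key.
case: ifP => xU; case: ifP => yU //; first by move=> _; apply: QT.
by case=> ->; rewrite tperm1 mul1g.
Qed.

End States.

(** * Relabellings realised by walks *)

Section Loops.
Variables (X : sgraph) (C : eqType) (col : X -> C).
Implicit Types (s g h k : {perm X}) (U : {set X}) (a b u v w x y z p q : X) (i : C).

Local Notation reach := (reach col).
Local Notation colour_preserving := (colour_preserving col).

Definition loop s g := colour_preserving g /\ reach s (s * g).

Lemma loop1 s : loop s 1.
Proof. by split; [apply: colour_preserving1|rewrite mulg1; apply: connect0]. Qed.

Lemma loopM s g h : loop s g -> loop s h -> loop s (g * h).
Proof.
move=> [cg rg] [ch rh]; split; first exact: colour_preservingM.
by apply: (reach_trans rh); rewrite mulgA; apply: reach_mulr.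
Qed.

Lemma loopV s g : loop s g -> loop s g^-1.
Proof.
move=> [cg rg]; split; first exact: colour_preservingV.
by have := reach_mulr (colour_preservingV cg) rg; rewrite mulgK reach_sym.
Qed.

Lemma loop_transport s s' g : reach s s' -> loop s g -> loop s' g.
Proof.
move=> r [cg rg]; split => //; rewrite reach_sym in r.
by apply: (reach_trans r); apply: (reach_trans rg); apply: reach_mulr; rewrite // reach_sym.
Qed.

Lemma loop_mulr s k g : colour_preserving k -> loop (s * k) g -> loop s (k * g * k^-1).
Proof.
move=> ck [cg rg]; have ckV := colour_preservingV ck; split.
  by apply: colour_preservingM => //; apply: colour_preservingM.
by have := reach_mulr ckV rg; rewrite mulgK !mulgA.
Qed.

Lemma mul_tpermr s a b : tperm a b * s = s * tperm (s a) (s b).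
Proof. by rewrite -tpermJ conjgE !mulgA mulgV mul1g. Qed.

Lemma reach_edge s a b : edge a b -> col (s a) != col (s b) \/ loop s (tperm (s a) (s b)) ->
  reach s (tperm a b * s).
Proof. by move=> ab [c|[_]]; [apply: reach_swap|rewrite mul_tpermr]. Qed.

(** Swapping equally coloured neighbours changes nothing up to relabelling and all other swaps are
    legal moves, so modulo [g] every edge transposition is available. *)
Lemma reach_up_to_colour s s' : connected X ->
  exists2 g, colour_preserving g & reach s (s' * g).
Proof.
move=> cX; pose Q s s' := exists2 g, colour_preserving g & reach s (s' * g).
have cT : set_connected [set: X].
  move=> x y _ _; apply: connect_sub (cX.2 x y) => u v uv.
  by apply: connect1; apply/and3P; rewrite uv !inE.
have -> : s' = (s' * s^-1) * s by rewrite mulgKV.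
apply: (@closed_under_edges _ [set: X] Q) => // [s1|s1 s2 s3|s1 u v|z].
- by exists 1; [apply: colour_preserving1|rewrite mulg1; apply: connect0].
- move=> [g cg rg] [h ch rh]; exists (h * g); first exact: colour_preservingM.
  by apply: (reach_trans rg); rewrite mulgA; apply: reach_mulr.
- case/and3P=> uv _ _; have [e|c] := eqVneq (col (s1 u)) (col (s1 v)).
    exists (tperm (s1 u) (s1 v)); first exact: colour_preserving_tperm.
    by rewrite mul_tpermr -mulgA tperm2 mulg1; apply: connect0.
  by exists 1; [apply: colour_preserving1|rewrite mulg1; apply: reach_swap].
- by rewrite inE.
Qed.

Lemma reach_all : connected X ->
  (forall s a b, edge a b -> col (s a) = col (s b) -> loop s (tperm (s a) (s b))) ->
  forall s s', reach s s'.
Proof.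
move=> cX sw s s'; have cT : set_connected [set: X].
  move=> x y _ _; apply: connect_sub (cX.2 x y) => u v uv.
  by apply: connect1; apply/and3P; rewrite uv !inE.
have -> : s' = (s' * s^-1) * s by rewrite mulgKV.
apply: (@closed_under_edges _ [set: X] (fun s s' => reach s s')) => // [s1|s1 s2 s3|s1 u v|z].
- exact: connect0.
- exact: reach_trans.
- case/and3P=> uv _ _; apply: reach_edge => //.
  by have [e|c] := eqVneq (col (s1 u)) (col (s1 v)); [right; apply: sw|left].
- by rewrite inE.
Qed.

Lemma reach_claw s v w a b :
  edge v w -> edge v a -> edge v b -> w != a -> w != b -> a != b ->
  col (s a) = col (s b) -> col (s v) != col (s a) -> col (s w) != col (s a) ->
  reach s (tperm a b * tperm v w * s).
Proof.
move=> vw va vb wa wb ab cab cv cw.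
have nv z : edge v z -> v != z by apply: contraTneq => ->; rewrite edge_irr.
have [[nw na] nb] := (nv w vw, nv a va, nv b vb).
have D1 : tperm v a w = w by rewrite tpermD // eq_sym.
have D2 : tperm v a b = b by rewrite tpermD.
have D3 : tperm v w a = a by rewrite tpermD.
have D4 : tperm v w b = b by rewrite tpermD.
have D5 : tperm v b a = a by rewrite tpermD // eq_sym.
have D6 : tperm v b w = w by rewrite tpermD // eq_sym.
have D7 : tperm a b v = v by rewrite tpermD // eq_sym.
have D8 : tperm a b w = w by rewrite tpermD // eq_sym.
pose E := (tpermL, tpermR, D1, D2, D3, D4, D5, D6, D7, D8).
(* The factor next to [s] is performed first: the swaps of [v] with [a], [w], [b], carried out twice
   in this order, each of a token with a blank. *)
have -> : tperm a b * tperm v w * s =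
    tperm v b * (tperm v w * (tperm v a * (tperm v b * (tperm v w * (tperm v a * s))))).
  apply/permP=> z; rewrite !permM.
  have [->|za] := eqVneq z a; first by rewrite !E.
  have [->|zb] := eqVneq z b; first by rewrite !E.
  have [->|zv] := eqVneq z v; first by rewrite !E.
  have [->|zw] := eqVneq z w; first by rewrite !E.
  by do !rewrite (@tpermD _ _ _ z) 1?eq_sym //.
apply: (reach_trans (reach_swap va cv)).
apply: (reach_trans (reach_swap vw _)); first by rewrite !permM !E eq_sym.
apply: (reach_trans (reach_swap vb _)); first by rewrite !permM !E -cab.
apply: (reach_trans (reach_swap va _)); first by rewrite !permM !E -cab eq_sym.
apply: (reach_trans (reach_swap vw _)); first by rewrite !permM !E.
by apply: (reach_swap vb); rewrite !permM !E eq_sym.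
Qed.

Definition blank i s := [set z | col (s z) != i].

Lemma blank_swap i s U u v : blank i s = tperm u v @: U -> blank i (tperm u v * s) = U.
Proof.
move=> e; apply/setP=> z; have /setP/(_ (tperm u v z)) := e.
by rewrite mem_imset ?inE ?permM //; apply: perm_inj.
Qed.

Lemma exch_move_colours i s U u v :
  u \in U -> v \notin U -> blank i s = U -> col (s u) != col (s v).
Proof.
move=> uU vU e; move: uU vU; rewrite -e !inE negbK => h /eqP ->; exact: h.
Qed.

(* Only one other colour: an exchange of a and b costs a swap of two blanks.  *)
Lemma exch_double i U a b :
  (forall z w, col z != i -> col w != i -> col z = col w) ->
  exch U a b -> forall s, blank i s = U -> a != b ->
  exists p q, [/\ p != q, col p != i, col q != i
                & loop s (tperm (s a) (s b) * tperm p q)].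
Proof.
move=> two E; elim: E => {U a b} [U a aU s sU|U a b c cU Eab IH1 Ebc IH2 s sU ac
   |U v w a b vU wU aU bU ab vw va vb s sU _|U u v a b uv uU vU Eab IH s sU ab].
- by rewrite eqxx.
- have [e|ab] := eqVneq a b; first by rewrite e; apply: IH2; rewrite // -e.
  have [e|bc] := eqVneq b c; first by rewrite -e; apply: IH1.
  have [p [q [pq ip iq l1]]] := IH1 s sU ab.
  have [p' [q' [pq' ip' iq' l2]]] := IH2 s sU bc.
  have [[aU bU] [_ cU']] := (exch_notin Eab, exch_notin Ebc).
  have tok z p0 : z \notin U -> col p0 != i -> s z != p0.
    rewrite -sU inE negbK => /eqP zi; apply: contraNneq => <-; exact/eqP.
  exists (tperm p' q' p), (tperm p' q' q); split.
  + by rewrite (inj_eq perm_inj).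
  + by case: tpermP.
  + by case: tpermP.
  (* Conjugating the first double transposition by the second sends [s b] to [s c] in the token part
     and only renames [p] and [q] in the blank part. *)
  have := loopM (loopM l2 l1) l2.
  suff -> : tperm (s b) (s c) * tperm p' q' * (tperm (s a) (s b) * tperm p q)
      * (tperm (s b) (s c) * tperm p' q') =
      tperm (s a) (s c) * tperm (tperm p' q' p) (tperm p' q' q) by [].
  have com y z p0 q0 : y \notin U -> z \notin U -> col p0 != i -> col q0 != i ->
      tperm p0 q0 * tperm (s y) (s z) = tperm (s y) (s z) * tperm p0 q0.
    by move=> yU zU p0i q0i; rewrite mul_tpermr !tpermD ?tok.
  rewrite -[tperm (tperm p' q' p) _]tpermJ conjgE tpermV.
  rewrite -(@tperm_chain _ (s a) (s b) (s c)) ?(inj_eq perm_inj) //.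
  have [c1 c2 c3] := And3 (com a b p' q' aU bU ip' iq') (com b c p q bU cU' ip iq)
    (com b c p' q' bU cU' ip' iq').
  rewrite -!mulgA (mulgA (tperm p' q')) c1 -!mulgA; congr (_ * (_ * _)).
  by rewrite (mulgA (tperm p q)) c2 -mulgA mulgA c3 -!mulgA.
- have [ia ib iv iw] : [/\ col (s a) = i, col (s b) = i, col (s v) != i & col (s w) != i].
    move: vU wU aU bU; rewrite -sU !inE !negbK => -> -> /eqP -> /eqP ->.
    by split.
  exists (s v), (s w); split=> //.
    by rewrite (inj_eq perm_inj); apply: contraTneq vw => ->; rewrite edge_irr.
  split.
    apply: colour_preservingM; apply: colour_preserving_tperm; first by rewrite ia ib.
    exact: two.
  rewrite mulgA -mul_tpermr -mulgA -mul_tpermr mulgA.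
  apply: reach_claw; rewrite ?ia ?ib //.
    by apply: contraNneq aU => <-.
  by apply: contraNneq bU => <-.
have sU1 := blank_swap sU; have c := exch_move_colours uU vU sU1.
have r : reach (tperm u v * s) s.
  by have := reach_swap uv c; rewrite mulgA tperm2 mul1g.
have ab' : a != b by apply: contraNneq ab => ->.
have [p [q [pq ip iq l]]] := IH _ sU1 ab'.
by exists p, q; split=> //; have := loop_transport r l; rewrite !permM.
Qed.

(* Blanks of several colours may first be rearranged inside U, so that two    *)
(* different colours sit on the claw.                                         *)
Definition loop_inside s U g :=
  exists2 h : {perm X}, forall z, z \notin U -> h z = z & loop (h * s) g.

(** The rearrangement is undone edge by edge inside [U]: between different colours this is a legal
    swap, and between equal colours a relabelling of blanks, which commutes with the transposition
    of the two tokens. *)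
Lemma loop_inside_connected s U a b :
  set_connected U -> a \notin U -> b \notin U ->
  loop_inside s U (tperm (s a) (s b)) -> loop s (tperm (s a) (s b)).
Proof.
move=> cU aU bU [h hU l].
pose Q s s' := [/\ s' a = s a, s' b = s b &
  loop s' (tperm (s a) (s b)) -> loop s (tperm (s a) (s b))].
suff [] : Q s (h * s) by move=> _ _; apply.
apply: (@closed_under_edges X U Q) => // {s h hU l} [s s1 s2|s u v].
  by move=> [e1 e2 l1] [f1 f2 l2]; rewrite /Q f1 f2 e1 e2 in l2 *; split=> // /l2.
case/and3P=> uv uU vU.
have ne z c : z \notin U -> c \in U -> c != z by move=> zU; apply: contraTneq => ->.
split; rewrite ?permM ?tpermD ?ne // => l.
have [e|c] := eqVneq (col (s u)) (col (s v)); last first.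
  by apply: loop_transport l; rewrite reach_sym; apply: reach_swap.
rewrite mul_tpermr in l; have := loop_mulr (colour_preserving_tperm e) l.
by rewrite tpermV mul_tpermr !tpermD 1?(inj_eq perm_inj) 1?eq_sym ?ne // -mulgA tperm2 mulg1.
Qed.

(** With the differently coloured blanks [p] and [q] on the claw, the side effect of the claw
    exchange is a swap of [p] and [q], which one legal move reverses. *)
Lemma exch_pure i U a b p q :
  col p != i -> col q != i -> col p != col q ->
  exch U a b -> forall s, blank i s = U -> loop_inside s U (tperm (s a) (s b)).
Proof.
move=> ip iq pq E; elim: E => {U a b} [U a aU s sU|U a b c cU Eab IH1 Ebc IH2 s sU
   |U v w a b vU wU aU bU ab vw va vb s sU|U u v a b uv uU vU Eab IH s sU].
- exists 1; first by move=> z _; rewrite perm1.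
  by rewrite tperm1; apply: loop1.
- have [[aU bU] [_ cU']] := (exch_notin Eab, exch_notin Ebc).
  exists 1; [by move=> z _; rewrite perm1|rewrite mul1g].
  have l1 := loop_inside_connected cU aU bU (IH1 s sU).
  have l2 := loop_inside_connected cU bU cU' (IH2 s sU).
  have [->|ab] := eqVneq a b; first exact: l2.
  have [->|ac] := eqVneq a c; first by rewrite tperm1; apply: loop1.
  rewrite -(@tperm_chain _ (s a) (s b) (s c)) ?(inj_eq perm_inj) //.
  by apply: loopM => //; apply: loopM.
- have [p'U q'U] : s^-1 p \in U /\ s^-1 q \in U by rewrite -sU !inE !permKV.
  have nvw : v != w by apply: contraTneq vw => ->; rewrite edge_irr.
  have pq' : s^-1 p != s^-1 q by rewrite (inj_eq perm_inj); apply: contraNneq pq => ->.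
  pose t := tperm v (s^-1 p).
  have tw : t w \in U by rewrite /t; case: tpermP.
  (* Chosen so that in [h * s] the blank [p] sits at [v] and [q] at [w]. *)
  pose h := t * tperm (t w) (s^-1 q).
  have hU z : z \notin U -> h z = z.
    move=> zU; have ne c : c \in U -> c != z by apply: contraTneq => ->.
    have tz : t z = z by rewrite /t tpermD ?ne.
    by rewrite /h permM tz tpermD ?ne.
  have hv : h v = s^-1 p.
    rewrite /h permM {2}/t tpermL tpermD 1?eq_sym //.
    by rewrite -{1}(tpermL v (s^-1 p)) (inj_eq perm_inj).
  have hw : h w = s^-1 q by rewrite /h permM tpermL.
  clearbody h.
  exists h => //.
  have [sv sw] : (h * s) v = p /\ (h * s) w = q by rewrite !permM hv hw !permKV.
  have [sa sb] : (h * s) a = s a /\ (h * s) b = s b by rewrite !permM !hU.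
  have [ia ib] : col (s a) = i /\ col (s b) = i.
    by move: aU bU; rewrite -sU !inE !negbK => /eqP -> /eqP ->.
  split; first by apply: colour_preserving_tperm; rewrite ia ib.
  rewrite -sa -sb -mul_tpermr.
  have r : reach (h * s) (tperm a b * tperm v w * (h * s)).
    apply: reach_claw; rewrite ?sa ?sb ?sv ?sw ?ia ?ib //.
      by apply: contraNneq aU => <-.
    by apply: contraNneq bU => <-.
  have ne z c : z \notin U -> c \in U -> z != c by move=> zU; apply: contraTneq => <-.
  have com : tperm v w * (tperm a b * tperm v w) = tperm a b.
    by rewrite mulgA mul_tpermr !tpermD ?ne // -mulgA tperm2 mulg1.
  apply: (reach_trans r); have -> : tperm a b * (h * s) = tperm v w * (tperm a b * tperm v w * (h * s)).
    by rewrite -[in LHS]com !mulgA.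
  apply: reach_swap => //.
  by rewrite !permM !(tpermD (x := a)) ?ne // tpermL tpermR -!permM sv sw eq_sym.
have sU1 := blank_swap sU.
have [h hU l] := IH _ sU1.
exists (tperm u v * h * tperm u v) => [z zU|].
  rewrite !permM hU ?tpermK //; apply: contraNN zU => zU.
  by apply/imsetP; exists (tperm u v z); rewrite ?tpermK.
rewrite !permM in l; apply: loop_transport l.
rewrite -!mulgA; apply: reach_swap => //.
apply: (@exch_move_colours i _ U) => //; apply/setP=> z.
rewrite !inE permM; move/setP/(_ (h z)): sU1; rewrite inE => ->.
have [zU|zU] := boolP (z \in U); last by rewrite hU // (negPf zU).
by apply/negPn/negP => hz; have := hU _ hz => /perm_inj e; rewrite e zU in hz.
Qed.

(** All that the algebra asks of the graph when class [i] provides the tokens. One set [U] is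
    enough, since [gather] can bring the blanks there. *)
Definition exch_colour i := exists2 U : {set X}, #|U| = #|[set z | col z != i]| &
  set_connected U /\ forall a b, a \notin U -> b \notin U -> a != b -> exch U a b.

Lemma gather i s x y :
  connected X -> exch_colour i -> col x = i -> col y = i -> x != y ->
  exists s' U a b, [/\ reach s s', blank i s' = U, s' a = x /\ s' b = y
    & [/\ set_connected U, a \notin U, b \notin U & exch U a b]].
Proof.
move=> cX [U cardU [cU EU]] xi yi xy.
have [s1 s1U] := perm_transport cardU.
have [g cg r] := reach_up_to_colour s s1 cX.
have bU : blank i (s1 * g) = U.
  apply/setP=> z; rewrite !inE permM cg.
  have := mem_imset U z (@perm_inj _ s1); rewrite s1U inE => <-; done.
have mU z : col z = i -> (s1 * g)^-1 z \notin U.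
  by move=> zi; rewrite -bU !inE permKV zi eqxx.
exists (s1 * g), U, ((s1 * g)^-1 x), ((s1 * g)^-1 y); split=> //; first by rewrite !permKV.
by split; rewrite ?mU //; apply: EU; rewrite ?mU // (inj_eq perm_inj).
Qed.

Lemma reach_all_multi : connected X ->
  (forall i, exists p q, [/\ col p != i, col q != i & col p != col q]) ->
  (forall x y, x != y -> col x = col y -> exch_colour (col x)) ->
  forall s s', reach s s'.
Proof.
move=> cX three Ecol; apply: reach_all => // s a b ab cab.
have sab : s a != s b.
  by rewrite (inj_eq perm_inj); apply: contraTneq ab => ->; rewrite edge_irr.
have [p [q [ip iq pq]]] := three (col (s a)).
have [s' [U [a' [b' [r bU [sa sb] [cU aU bU' E]]]]]] :=
  gather s cX (Ecol _ _ sab cab) erefl (esym cab) sab.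
rewrite -sa -sb; rewrite reach_sym in r; apply: loop_transport r _.
by apply: (loop_inside_connected cU aU bU'); apply: (exch_pure ip iq pq E).
Qed.

End Loops.

(** * Two colours *)

Section OddNormal.
Variables (T : finType) (B : pred T) (N : {perm T} -> Prop).
Hypothesis N1 : N 1.
Hypothesis NM : forall g h, N g -> N h -> N (g * h).
Hypothesis NV : forall g, N g -> N g^-1.
Hypothesis NJ : forall x y g, B x -> B y -> N g -> N (g ^ tperm x y).
Implicit Types x y z p q r : T.

Lemma tperm_conjB x y p q : B x -> B y -> N (tperm p q) ->
  N (tperm (tperm x y p) (tperm x y q)).
Proof. by move=> Bx By h; rewrite -tpermJ; apply: NJ. Qed.

Lemma transpositions_of_transposition x y :
  B x -> B y -> x != y -> N (tperm x y) ->
  forall p q, B p -> B q -> p != q -> N (tperm p q).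
Proof.
move=> Bx By xy Nxy p q Bp Bq pq; have := tperm_conjB Bx Bp Nxy.
rewrite tpermL; set y1 := tperm x p y.
have By1 : B y1 by rewrite /y1; case: tpermP.
have py1 : p != y1 by rewrite -(tpermL x p) (inj_eq perm_inj).
by move=> h; have := tperm_conjB By1 Bq h; rewrite tpermL tpermD 1?eq_sym.
Qed.

Lemma three_cycles x y z :
  B x -> B y -> B z -> x != y -> x != z -> y != z -> N (tperm x y * tperm x z) ->
  forall p q r, B p -> B q -> B r -> p != q -> p != r -> q != r ->
  N (tperm p q * tperm p r).
Proof.
move=> Bx By Bz xy xz yz Nxyz p q r Bp Bq Br pq pr qr.
have J u v a b c : B u -> B v -> N (tperm a b * tperm a c) ->
    N (tperm (tperm u v a) (tperm u v b) * tperm (tperm u v a) (tperm u v c)).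
  by move=> Bu Bv h; rewrite -!tpermJ -conjMg; apply: NJ.
have BT u v a : B u -> B v -> B a -> B (tperm u v a) by move=> *; case: tpermP.
have h1 := J _ _ _ _ _ Bx Bp Nxyz; rewrite tpermL in h1.
have [By1 Bz1] : B (tperm x p y) /\ B (tperm x p z) by split; apply: BT.
have py1 : p != tperm x p y by rewrite -{1}(tpermL x p) (inj_eq perm_inj).
have pz1 : p != tperm x p z by rewrite -{1}(tpermL x p) (inj_eq perm_inj).
have yz1 : tperm x p y != tperm x p z by rewrite (inj_eq perm_inj).
move: (tperm x p y) (tperm x p z) By1 Bz1 py1 pz1 yz1 h1 => y1 z1 By1 Bz1 py1 pz1 yz1 h1.
have := J _ _ _ _ _ By1 Bq h1; rewrite tpermL tpermD 1?eq_sym //.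
have Bz2 : B (tperm y1 q z1) by apply: BT.
have pz2 : p != tperm y1 q z1.
  have pfix : tperm y1 q p = p by rewrite tpermD // eq_sym.
  by rewrite -{1}pfix (inj_eq perm_inj).
have qz2 : q != tperm y1 q z1 by rewrite -{1}(tpermL y1 q) (inj_eq perm_inj).
move: (tperm y1 q z1) Bz2 pz2 qz2 => z2 Bz2 pz2 qz2 h2.
by have := J _ _ _ _ _ Bz2 Br h2; rewrite tpermL !tpermD 1?eq_sym // eq_sym.
Qed.

Variable h : {perm T}.
Hypothesis Nh : N h.
Hypothesis hB : forall z, ~~ B z -> h z = z.
Hypothesis oh : odd_perm h.

(** Three-cycles generate all even permutations of [B], and a transposition is an even permutation
    times the inverse of the odd [h]. *)
Lemma transpositions_of_three_cycles x y z :
  B x -> B y -> B z -> x != y -> x != z -> y != z -> N (tperm x y * tperm x z) ->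
  forall p q, B p -> B q -> p != q -> N (tperm p q).
Proof.
move=> Bx By Bz xy xz yz Nxyz; have tri := three_cycles Bx By Bz xy xz yz Nxyz.
have dbl1 a b d : B a -> B b -> B d -> a != b -> a != d -> N (tperm a b * tperm a d).
  move=> Ba Bb Bd ab ad; have [->|bd] := eqVneq b d; first by rewrite tperm2.
  exact: tri.
have dbl a b c d : B a -> B b -> B c -> B d -> a != b -> c != d ->
    N (tperm a b * tperm c d).
  move=> Ba Bb Bc Bd ab cd; have [e|ac] := eqVneq a c.
    by rewrite -e in cd *; apply: dbl1.
  have -> : tperm a b * tperm c d = (tperm a b * tperm a c) * (tperm c a * tperm c d).
    by rewrite [tperm c a]tpermC -!mulgA tpermKg.
  by apply: NM; apply: dbl1; rewrite // eq_sym.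
pose key z := if B z then None else Some z.
have all (g : {perm T}) : (forall z, key (g z) = key z) -> if odd_perm g then
    (forall p q, B p -> B q -> p != q -> N (tperm p q * g)) else N g.
  move: g; apply: tperm_ind => [|x1 y1 g kxy IH]; first by rewrite odd_perm1.
  move: kxy; rewrite /key; case: ifP => Bx1; case: ifP => By1 //; last first.
    by case=> ->; rewrite tperm1 mul1g.
  have [->|xy1] := eqVneq x1 y1; first by rewrite tperm1 mul1g.
  move=> _; rewrite odd_mul_tperm xy1 /=; case: (odd_perm g) IH => /= IH.
    have -> : tperm x1 y1 * g = (tperm x1 y1 * tperm x y) * (tperm x y * g).
      by rewrite -mulgA tpermKg.
    by apply: NM; [apply: dbl|apply: IH].
  by move=> p q Bp Bq pq; rewrite mulgA; apply: NM => //; apply: dbl.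
have kh w : key (h w) = key w.
  rewrite /key; have [Bw|Bw] := boolP (B w); last by rewrite hB // (negPf Bw).
  case: ifPn => // Bhw; have := hB Bhw => /perm_inj e.
  by rewrite e Bw in Bhw.
have := all h kh; rewrite oh => Nph p q Bp Bq pq.
have -> : tperm p q = tperm p q * h * h^-1 by rewrite mulgK.
by apply: NM; [apply: Nph|apply: NV].
Qed.

(** The commutator of [h] with the transposition of [x] and [y] is a product of two transpositions.
    It is a three-cycle at once if [h] is no involution; an odd involution that is not a
    transposition moves enough points to produce one from two such commutators. *)
Lemma transpositions_of_odd p q : B p -> B q -> p != q -> N (tperm p q).
Proof.
have BN z : h z != z -> B z by apply: contraNT => /hB ->.
have Bh z : B z -> B (h z).
  by move=> Bz; apply: contraTT Bz => Bhz; have := hB Bhz => /perm_inj <-.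
have comm x y : B x -> B y -> N (tperm (h x) (h y) * tperm x y).
  move=> Bx By; have -> : tperm (h x) (h y) * tperm x y = h^-1 * h ^ tperm x y.
    by rewrite -tpermJ !conjgE tpermV !mulgA.
  by apply: NM; [apply: NV|apply: NJ].
have [/existsP[x hhx]|/existsPn inv] := boolP [exists x, h (h x) != x].
  have hx : h x != x by apply: contraNneq hhx => e; rewrite !e.
  have [h2|h2] := eqVneq (h (h x)) (h x).
    by move/perm_inj: h2 hx => ->; rewrite eqxx.
  apply: (@transpositions_of_three_cycles (h x) (h (h x)) x) => //; rewrite ?Bh ?BN //.
    by rewrite eq_sym.
  by have := comm _ _ (BN _ hx) (Bh _ (BN _ hx)); rewrite [tperm x _]tpermC.
have {}inv z : h (h z) = z by apply/eqP/negPn/inv.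
have [/existsP[x hx]|/existsPn h1] := boolP [exists x, h x != x]; last first.
  suff e : h = 1 by move: oh; rewrite e odd_perm1.
  by apply/permP => z; rewrite perm1; apply/eqP/negPn/h1.
have Bx := BN _ hx; have Bhx := Bh _ Bx.
have [e|/eqP ne] := eqVneq h (tperm x (h x)).
  by apply: (@transpositions_of_transposition x (h x)); rewrite // 1?eq_sym // -e.
have [/existsP[y hy]|/existsPn h1] := boolP [exists y, h y != tperm x (h x) y]; last first.
  by case: ne; apply/permP => z; apply/eqP/negPn/h1.
have yx : x != y by apply: contraNneq hy => <-; rewrite tpermL.
have yhx : h x != y by apply: contraNneq hy => <-; rewrite tpermR inv.
rewrite tpermD // in hy; have By := BN _ hy.
have hxy : h x != h y by rewrite (inj_eq perm_inj).
have xhy : x != h y by apply: contraNneq yhx => ->; rewrite inv.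
(* A product of exactly two transpositions is even, so [h] moves some fifth point [z]. *)
have [/existsP[z hz]|/existsPn h1] :=
  boolP [exists z, h z != (tperm x (h x) * tperm y (h y)) z]; last first.
  have e : h = tperm x (h x) * tperm y (h y) by apply/permP => z; apply/eqP/negPn/h1.
  by move: oh; rewrite {1}e odd_mul_tperm odd_tperm ![_ == h _]eq_sym hx hy.
have zx : x != z.
  by apply: contraNneq hz => <-; rewrite permM tpermL tpermD // eq_sym.
have zhx : h x != z.
  by apply: contraNneq hz => <-; rewrite permM tpermR inv tpermD // eq_sym.
have zy : y != z.
  by apply: contraNneq hz => <-; rewrite permM (tpermD yx yhx) tpermL.
have zhy : h y != z.
  by apply: contraNneq hz => <-; rewrite permM (tpermD xhy hxy) tpermR inv.
rewrite permM !tpermD // in hz; have Bz := BN _ hz.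
have D := comm _ _ Bx By.
have E1 : tperm y z (h x) = h x by rewrite tpermD // eq_sym.
have E2 : tperm y z (h y) = h y by rewrite tpermD // eq_sym.
have E3 : tperm y z x = x by rewrite tpermD // eq_sym.
have := NJ By Bz D; rewrite conjMg !tpermJ tpermL E1 E2 E3 => D'.
apply: (@transpositions_of_three_cycles x y z) => //.
by have := NM (NV D) D'; rewrite invMg !tpermV -mulgA tpermKg.
Qed.

End OddNormal.

Section TwoColours.
Variables (X : sgraph) (C : eqType) (col : X -> C).
Hypothesis cX : connected X.
Hypothesis two : forall x y z, col x != col y -> col z = col x \/ col z = col y.
Implicit Types (s g h k : {perm X}) (x y z p q : X) (e : bool).

Local Notation reach := (reach col).
Local Notation loop := (loop col).

(* x and y behave as the ends of a walk of parity e: trading their contents   *)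
(* costs e swaps modulo 2, up to recolouring, if the contents differ.         *)
Definition trade e x y := [forall s : {perm X}, [exists s' : {perm X},
  [&& reach s s', [forall z, col (s' z) == col ((tperm x y * s) z)]
    & odd_perm s' (+) odd_perm s == e && (col (s x) != col (s y))]]].

Lemma tradeP e x y : reflect (forall s, exists s', [/\ reach s s',
    forall z, col (s' z) = col (s (tperm x y z))
    & odd_perm s' (+) odd_perm s = e && (col (s x) != col (s y))]) (trade e x y).
Proof.
apply: (iffP forallP) => h s.
  have /existsP[s' /and3P[r /forallP c /eqP o]] := h s.
  by exists s'; split=> // z; rewrite (eqP (c z)) permM.
have [s' [r c o]] := h s; apply/existsP; exists s'; rewrite r o eqxx andbT.
by apply/forallP => z; rewrite c permM.
Qed.

Lemma trade_edge x y : edge x y -> trade true x y.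
Proof.
move=> xy; apply/tradeP => s; have nxy : x != y.
  by apply: contraTneq xy => ->; rewrite edge_irr.
have [e|c] := eqVneq (col (s x)) (col (s y)); [exists s|exists (tperm x y * s)]; split.
- exact: connect0.
- by move=> z; case: tpermP => // ->.
- by rewrite addbb.
- exact: reach_swap.
- by move=> z; rewrite permM.
- by rewrite odd_mul_tperm nxy -addbA addbb.
Qed.

(** The transposition of [x] and [z] is that of [x] and [y] conjugated by that of [y] and [z]. With
    two colours, the contents of [x], [y] differ plus those of [y], [z] differ equals those of [x],
    [z] differ modulo 2, so the two outer trades together flip the parity exactly when needed. *)
Lemma trade_step e x y z : x != y -> x != z -> edge y z -> trade e x y -> trade (~~ e) x z.
Proof.
move=> xy xz yz /tradeP Wxy; have nyz : y != z.
  by apply: contraTneq yz => ->; rewrite edge_irr.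
have /tradeP Wyz := trade_edge yz; apply/tradeP => s.
have [s1 [r1 c1 o1]] := Wyz s; have [s2 [r2 c2 o2]] := Wxy s1.
have [s3 [r3 c3 o3]] := Wyz s2; exists s3; split.
- by apply: (reach_trans r1); apply: (reach_trans r2).
- move=> w; rewrite c3 c2 c1 -!permM !mulgA.
  by rewrite -(tperm_chain xy xz).
have D1 : tperm y z x = x by rewrite tpermD // eq_sym.
have D2 : tperm x y z = z by rewrite tpermD // eq_sym.
have -> : odd_perm s3 (+) odd_perm s = (odd_perm s3 (+) odd_perm s2)
    (+) ((odd_perm s2 (+) odd_perm s1) (+) (odd_perm s1 (+) odd_perm s)).
  by case: (odd_perm s3) (odd_perm s2) (odd_perm s1) (odd_perm s) => [] [] [] [].
rewrite o1 o2 o3 !c2 !c1 tpermR D2 !tpermR tpermL D1.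
have tri : (col (s x) != col (s y)) (+) (col (s y) != col (s z)) = (col (s x) != col (s z)).
  have [->|xyc] := eqVneq (col (s x)) (col (s y)); first by rewrite addFb.
  have [->|->] := two (s z) xyc; last by rewrite eqxx xyc.
  by rewrite eqxx eq_sym xyc.
rewrite -tri; case: (e); case: (col (s x) != col (s y)); case: (col (s y) != col (s z)) => //.
Qed.

(** If every vertex had only one parity of trade with a fixed [x0], that parity would be a proper
    2-colouring of [X]. *)
Lemma odd_trade : ~ bipartite X ->
  exists x y, [/\ x != y, trade false x y & trade true x y].
Proof.
move=> nb; have [/existsP[x /existsP[y /and3P[xy t0 t1]]]|h] :=
  boolP [exists x, exists y, [&& x != y, trade false x y & trade true x y]].
  by exists x, y.
case: nb; have /card_gt0P[x0 _] := cX.1.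
have {}h y : x0 != y -> trade false x0 y -> trade true x0 y -> False.
  move=> xy t0 t1; case/existsP: h; exists x0; apply/existsP; exists y.
  by rewrite xy t0.
pose P y := [|| x0 == y, trade false x0 y | trade true x0 y].
have clP : closed (@edge X) P.
  apply: intro_closed; first exact: sym_connect_sym (@edge_sym X).
  move=> y z yz; rewrite !unfold_in /P.
  have [//|xz] := eqVneq x0 z; have [->|xy] := eqVneq x0 y.
    by rewrite (trade_edge yz) orbT.
  by move=> /= /orP[] t; have := trade_step xy xz yz t => /= ->; rewrite ?orbT.
have Pall y : P y.
  by have := closed_connect clP (cX.2 x0 y); rewrite !unfold_in {1}/P eqxx => <-.
exists (fun y => (x0 != y) && trade true x0 y) => y z yz.
have nyz : y != z by apply: contraTneq yz => ->; rewrite edge_irr.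
have [xy|xy] /= := eqVneq x0 y.
  by rewrite xy nyz (trade_edge yz).
have [xz|xz] /= := eqVneq x0 z.
  by rewrite xz (trade_edge (_ : edge z y)) // edge_sym.
have [t1|t1] := boolP (trade true x0 y).
  by rewrite eq_sym eqb_id; apply/negP; apply: h => //; apply: trade_step t1.
have := Pall y; rewrite /P (negPf xy) (negPf t1) orbF /= => t0.
by rewrite (trade_step xy xz yz t0).
Qed.

(** Put [p] and [q] of different colours on a pair with trades of both parities. The two results
    have the same colouring and opposite signs, so they differ by an odd relabelling. *)
Lemma odd_loop s : ~ bipartite X -> (exists p q, col p != col q) ->
  exists2 g, loop s g & odd_perm g.
Proof.
move=> nb [p [q pq]]; have [x [y [xy /tradeP t0 /tradeP t1]]] := odd_trade nb.
have npq : p != q by apply: contraNneq pq => ->.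
pose t := tperm x p; pose s1 := t * tperm (t y) q.
have ty : p != t y by rewrite -{1}(tpermL x p) (inj_eq perm_inj).
have s1x : s1 x = p by rewrite permM {2}/t tpermL tpermD // eq_sym.
have s1y : s1 y = q by rewrite permM tpermL.
clearbody s1.
have [g cg r] := reach_up_to_colour col s s1 cX.
have [s' [r' c' o']] := t0 (s1 * g); have [s'' [r'' c'' o'']] := t1 (s1 * g).
have cxy : col ((s1 * g) x) != col ((s1 * g) y) by rewrite !permM !cg s1x s1y.
rewrite cxy /= in o' o''.
exists (s'^-1 * s''); last first.
  rewrite odd_permM odd_permV; move: o' o''.
  by case: (odd_perm s') (odd_perm s'') (odd_perm (s1 * g)) => [] [] [].
have rs : reach s' s by rewrite reach_sym; apply: reach_trans r r'.
apply: (loop_transport rs); split.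
  by move=> z; rewrite permM c'' -c' permKV.
rewrite mulKVg; apply: reach_trans r''; rewrite reach_sym; exact: r'.
Qed.

Hypothesis double : forall s x y, x != y -> col x = col y ->
  exists p q, [/\ p != q, col p != col x, col q != col x & loop s (tperm x y * tperm p q)].

(* Each transposition of g outside the class i is traded for one inside it.   *)
Lemma loop_concentrate (i : C) s g : (exists x, col x = i) -> colour_preserving col g ->
  exists h, [/\ forall z, col z != i -> h z = z, odd_perm h = odd_perm g & loop s (g * h)].
Proof.
move=> [x0 x0i] cg; pose P (g : {perm X}) := colour_preserving col g /\
  exists h : {perm X}, [/\ forall z, col z != i -> h z = z,
  odd_perm h = odd_perm g & loop s (g * h)].
suff [_] : P g by [].
move: g cg; apply: (@tperm_ind _ _ col) => [|x y g xyc [cg [h [hi oh l]]]].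
  split; first exact: colour_preserving1.
  by exists 1; split=> //; [move=> z _; rewrite perm1|rewrite mulg1; apply: loop1].
split; first by apply: colour_preservingM => //; apply: colour_preserving_tperm.
have [e|xy] := eqVneq x y; first by exists h; rewrite e tperm1 mul1g.
have fix_ p q z : col p = i -> col q = i -> col z != i -> (tperm p q * h) z = z.
  move=> ip iq iz; rewrite permM tpermD ?hi //.
    by apply: contraNneq iz => <-; rewrite ip.
  by apply: contraNneq iz => <-; rewrite iq.
have [xi|xi] := eqVneq (col x) i.
  exists (tperm (g x) (g y) * h); split.
  - by move=> z; apply: fix_; rewrite cg // -xyc.
  - by rewrite !odd_mul_tperm (inj_eq perm_inj) oh.
  by rewrite mulgA -(mulgA _ g) -mul_tpermr mulgA tperm2 mul1g.
have [p [q [pq px qx lpq]]] := double s xy xyc.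
have toi z : col z != col x -> col z = i.
  have cx0 : col x != col x0 by rewrite x0i.
  by case: (two z cx0) => [->|->]; rewrite ?eqxx.
exists (tperm (g p) (g q) * h); split.
- by move=> z; apply: fix_; rewrite cg toi.
- by rewrite !odd_mul_tperm (inj_eq perm_inj) xy pq oh.
by rewrite mulgA -(mulgA _ g) -mul_tpermr mulgA -mulgA; apply: loopM.
Qed.

(** The loops supported on the class of [s a] contain an odd element by [loop_concentrate] and are
    normalised by the transpositions of that class, so [transpositions_of_odd] applies. *)
Lemma reach_all_two : ~ bipartite X -> (exists p q, col p != col q) ->
  forall s s', reach s s'.
Proof.
move=> nb npq; apply: reach_all => // s a b ab cab; move: (odd_loop s nb npq) => [g lg og].
have sab : s a != s b.
  by rewrite (inj_eq perm_inj); apply: contraTneq ab => ->; rewrite edge_irr.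
pose i := col (s a); pose B := [pred z | col z == i].
have [h [hB oh lh]] := loop_concentrate s (ex_intro _ (s a) (erefl i)) lg.1.
pose N (g : {perm X}) := loop s g /\ forall z, ~~ B z -> g z = z.
suff [] : N (tperm (s a) (s b)) by [].
have [Ba Bb] : B (s a) /\ B (s b) by rewrite /= -cab eqxx.
apply: (@transpositions_of_odd _ B N _ _ _ _ h) => //; last by rewrite oh.
- by split; [apply: loop1|move=> z _; rewrite perm1].
- move=> g1 g2 [l1 f1] [l2 f2]; split; first exact: loopM.
  by move=> z zB; rewrite permM f1 ?f2.
- move=> g1 [l1 f1]; split; first exact: loopV.
  by move=> z zB; rewrite -{1}(f1 z zB) permK.
- move=> x y g1 Bx By [l1 f1].
  have fJ z : ~~ B z -> (g1 ^ tperm x y) z = z.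
    move=> zB; have zx : tperm x y z = z.
      by rewrite tpermD //; apply: contraNneq zB => <-.
    by rewrite -{1}zx permJ f1.
  split=> //; have [->|xy] := eqVneq x y; first by rewrite tperm1 conjg1.
  have [p [q [pq px qx lpq]]] := double s xy (etrans (eqP Bx) (esym (eqP By))).
  (* [p] and [q] lie outside the class, so their transposition commutes with a permutation supported
     on it. *)
  suff -> : g1 ^ tperm x y = g1 ^ (tperm x y * tperm p q).
    by rewrite conjgE; apply: loopM; [apply: loopV|apply: loopM].
  rewrite conjgM [RHS]conjgE tpermV mulgA mul_tpermr.
  by rewrite !fJ ?inE -?(eqP Bx) // -mulgA tperm2 mulg1.
- split; last exact: hB.
  by have := loopM (loopV lg) lh; rewrite mulKg.
Qed.

End TwoColours.

Lemma loop_double (X : sgraph) (C : eqType) (col : X -> C) (s : {perm X}) x y :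
  connected X -> exch_colour col (col x) ->
  (forall x y z, col x != col y -> col z = col x \/ col z = col y) ->
  x != y -> col x = col y ->
  exists p q, [/\ p != q, col p != col x, col q != col x & loop col s (tperm x y * tperm p q)].
Proof.
move=> cX E two xy cxy.
have [s' [U [a [b [r bU [sa sb] [cU aU bU' Eab]]]]]] := gather s cX E erefl (esym cxy) xy.
have twoi z w : col z != col x -> col w != col x -> col z = col w.
  move=> zx wx; case: (two x z w); rewrite // 1?eq_sym // => e.
  by rewrite e eqxx in wx.
have ab : a != b by apply: contraNneq xy => e; rewrite -sa -sb e.
have [p [q [pq px qx l]]] := exch_double twoi Eab bU ab.
exists p, q; split=> //; rewrite sa sb in l; rewrite reach_sym in r.
exact: loop_transport r l.
Qed.

End Permutations.

(** * Back to friends-and-strangers graphs *)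

Lemma connect_map (S T : finType) (e : rel S) (e' : rel T) (f : S -> T) :
  (forall x y, e x y -> e' (f x) (f y)) ->
  forall x y, connect e x y -> connect e' (f x) (f y).
Proof.
move=> ef x y /connectP[p]; elim: p x => [x _ ->|z p IH x /= /andP[xz zp] lp].
  exact: connect0.
exact: connect_trans (connect1 (ef _ _ xz)) (IH z zp lp).
Qed.

Lemma card_bijection (S T : finType) : #|S| = #|T| ->
  exists f : S -> T, exists g : T -> S, cancel f g /\ cancel g f.
Proof.
move=> ST; exists (fun x => enum_val (cast_ord ST (enum_rank x))).
exists (fun y => enum_val (cast_ord (esym ST) (enum_rank y))).
by split=> x; rewrite enum_valK ?cast_ordK ?cast_ordKV enum_rankK.
Qed.

Lemma card_part (k : seq nat) (i : 'I_(size k)) :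
  #|[set y : cmp_vertex k | tag y == i]| = nth 0 k i.
Proof.
pose f (j : 'I_(nth 0 k i)) : cmp_vertex k := Tagged (fun i : 'I_(size k) => 'I_(nth 0 k i)) j.
have fI : injective f by move=> j j' /eqP; rewrite eq_Tagged /= => /eqP.
rewrite -[RHS]card_ord -(card_imset predT fI); apply: eq_card => y.
rewrite inE; apply/eqP/imsetP => [|[j _ ->] //].
by case: y => i' j /= e; move: j; rewrite e => j; exists j.
Qed.

Lemma card_cmp_vertex (k : seq nat) : #|cmp_vertex k| = sumn k.
Proof.
rewrite card_tagged sumnE big_map big_enum /=.
under eq_bigr do rewrite card_ord.
by rewrite sumnE (big_nth 0) big_mkord.
Qed.

(** A fixed bijection [f] between the two vertex sets turns bijections into permutations of [X] and
    the parts into colour classes. *)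
Lemma FS_multipartite_connected (X : sgraph) (k : seq nat) :
  #|X| = sumn k ->
  (forall col : X -> 'I_(size k),
     (forall i, #|[set x | col x == i]| = nth 0 k i) ->
     forall s s', reach col s s') ->
  connected (FS X (complete_multipartite k)).
Proof.
move=> Xk H; pose Y := complete_multipartite k.
have [f [g [fK gK]]] : exists f : X -> Y, exists g : Y -> X, cancel f g /\ cancel g f.
  by apply: card_bijection; rewrite Xk -card_cmp_vertex.
have fI := can_inj fK; pose col x := tag (f x).
have reach_col : forall s s', reach col s s'.
  apply: H => i; rewrite -card_part -(card_imset _ fI); apply: eq_card => y.
  rewrite inE; apply/imsetP/eqP => [[x + ->]|<-]; first by rewrite inE => /eqP.
  by exists (g y); rewrite ?inE /col ?gK.
have bij (s : {perm X}) : bijectiveb [ffun x => f (s x)].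
  apply/andP; split; first by apply/injectiveP => x x'; rewrite !ffunE => /fI/perm_inj.
  apply/forallP => y; apply/codomP; exists ((s^-1)%g (g y)).
  by rewrite ffunE permKV gK.
pose mk s : FS X Y := exist (@bijectiveb X Y) _ (bij s).
have mkE (u : FS X Y) : exists s, u = mk s.
  case: u => u pu; have /andP[/injectiveP uI _] := pu.
  have guI : injective (fun x => g (u x)) by move=> x x' /(can_inj gK)/uI.
  exists (perm guI); apply: val_inj; apply/ffunP => x.
  by rewrite /= ffunE permE gK.
split=> [|u u']; first by apply/card_gt0P; exists (mk 1%g).
have [s ->] := mkE u; have [s' ->] := mkE u'.
apply: connect_map (reach_col s s') => {s s'} s s'.
case/existsP=> a /existsP[b /and3P[ab cab /eqP ->]].
apply/existsP; exists a; apply/existsP; exists b.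
rewrite ab /= !ffunE !permM tpermL tpermR !eqxx /=; apply/andP; split=> //.
apply/forallP => c; apply/implyP => /andP[ca cb].
by rewrite !ffunE permM tpermD // eq_sym.
Qed.

Lemma exch_colour_no_bridge (X : sgraph) (C : eqType) (col : X -> C) i K :
  connected X -> ~ is_cycle X -> ~ has_bridge X K -> 1 < K ->
  #|[set x | col x != i]| = K -> exch_colour col i.
Proof.
move=> cX nc nb K1 cK; have KX : 0 < K <= #|X| by rewrite ltnW // -cK max_card.
have [U UK cU] := connected_set_exists cX KX.
exists U; first by rewrite UK cK.
by split=> // a b aU bU _; apply: (exch_all cX nc nb K1).
Qed.

(** For a class of two members the only tokens are [a] and [b], so [U] is the complement of that
    pair and [exch_two] applies. *)
Lemma exch_colour_pair (X : sgraph) (C : eqType) (col : X -> C) i :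
  connected X -> (exists v : X, 2 < degree v) -> 3 < #|X| ->
  #|[set x | col x == i]| = 2 -> exch_colour col i.
Proof.
move=> cX dX X4 c2; have e : [set x | col x != i] = ~: [set x | col x == i].
  by apply/setP=> z; rewrite !inE.
have KX : 0 < #|[set x | col x != i]| <= #|X|.
  by rewrite max_card andbT e cardsCs setCK c2 subn_gt0; apply: ltn_trans X4.
have [U UK cU] := connected_set_exists cX KX.
exists U => //; split=> // a b aU bU ab.
suff -> : U = ~: [set a; b] by apply: exch_two.
apply: setC_inj; rewrite setCK; apply/esym/eqP; rewrite eqEcard; apply/andP; split.
  by apply/subsetP=> z; rewrite !inE => /orP[] /eqP ->.
by rewrite cards2 ab cardsCs setCK UK e -cardsCs c2.
Qed.

Theorem theorem1p5 (t n : nat) (k : seq nat) (X : sgraph)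
    (ht : 2 <= t) (hsize : size k = t) (hk : path leq 1 k)
    (hn : n = sumn k) (hn4 : 4 <= n) (hX : #|X| = n) :
  [/\ t = 2 -> 2 <= head 0 k ->
      connected X -> ~ bipartite X -> ~ is_cycle X ->
      ~ has_bridge X (head 0 k) ->
      connected (FS X (complete_multipartite [:: head 0 k; n - head 0 k])),
      2 < t -> (2 < last 0 k \/ 1 < \big[gcdn/0]_(i <- k) i) ->
      connected X -> ~ is_cycle X -> ~ is_tree X ->
      ~ has_bridge X (n - last 0 k) ->
      connected (FS X (complete_multipartite k))
    & 2 < t -> head 0 k = 1 -> last 0 k = 2 ->
      connected X -> ~ is_cycle X -> ~ is_tree X ->
      connected (FS X (complete_multipartite k))].
Proof.
have k1 i : i < size k -> 0 < nth 0 k i.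
  by move=> ik; apply: (allP (order_path_min leq_trans hk)); apply: mem_nth.
have kmax i : i < size k -> nth 0 k i <= last 0 k.
  move=> ik; rewrite -nth_last; have k0 : 0 < size k by apply: leq_trans ik.
  have := sorted_leq_nth leq_trans leqnn 0 (path_sorted hk).
  by apply; rewrite ?inE ?prednK // -ltnS prednK.
have compl (C : eqType) (col : X -> C) i :
    #|[set x | col x != i]| = n - #|[set x | col x == i]|.
  rewrite -hX -[in RHS](cardsC [set x | col x == i]) addKn; apply: eq_card => x.
  by rewrite !inE.
have three (col : X -> 'I_(size k)) : 2 < t ->
    (forall i, #|[set x | col x == i]| = nth 0 k i) ->
    forall i, exists p q, [/\ col p != i, col q != i & col p != col q].
  move=> t2 ccol i; have : 1 < #|[set~ i]| by rewrite cardsC1 card_ord hsize -ltnS prednK ?(ltnW ht).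
  case/card_gt1P=> j [l []]; rewrite !inE => ji li jl.
  have wit c : exists x, col x = c.
    have /card_gt0P[x] : 0 < #|[set x | col x == c]| by rewrite ccol k1.
    by rewrite inE => /eqP; exists x.
  by have [[p pj] [q ql]] := (wit j, wit l); exists p, q; rewrite pj ql.
split.
- move=> t2 h2 cX nb nc nbr; rewrite t2 in hsize.
  case: k hsize hk hn h2 nbr {k1 kmax three} => [|a [|b [|//]]] // _ /= /and3P[_ ab _] hn a2 nbr.
  rewrite addn0 in hn; have nab : n - a = b by rewrite hn addKn.
  apply: FS_multipartite_connected => [|col ccol]; first by rewrite nab hX hn /= addn0.
  have two x y z : col x != col y -> col z = col x \/ col z = col y.
    move: (col x) (col y) (col z) => [[|[|i]] hi] [[|[|j]] hj] [[|[|l]] hl] // _;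
    by [left; apply: val_inj|right; apply: val_inj].
  have [ca cb] : #|[set x | col x == ord0]| = a /\ #|[set x | col x == ord_max]| = b.
    by rewrite !ccol /= nab.
  (* The blanks for either class are the members of the other one; there are at least [a] of them,
     so a bridge of that length would contain one of length [a]. *)
  have EC i : exch_colour col i.
    have cK := compl _ col i; move: cK; rewrite ccol.
    move=> cK; apply: (exch_colour_no_bridge cX nc _ _ cK).
      apply: contra_not nbr; apply: has_bridge_le => //.
      by case: (i) => [[|[|//]] _] /=; rewrite nab // hn addnK.
    apply: leq_trans a2 _.
    by case: (i) => [[|[|//]] _] /=; rewrite nab // hn addnK.
  apply: reach_all_two => //.
    by move=> s x y xy cxy; apply: loop_double.
  have /card_gt0P[p] : 0 < #|[set x | col x == ord0]| by rewrite ca ltnW.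
  have /card_gt0P[q] : 0 < #|[set x | col x == ord_max]|.
    by rewrite cb (leq_trans _ ab) // ltnW.
  by rewrite !inE => /eqP qm /eqP p0; exists p, q; rewrite qm p0.
- move=> t2 _ cX nc _ nbr; apply: FS_multipartite_connected => [|col ccol]; first by rewrite hX.
  (* At least two blanks, because two colours remain outside class [i]; for the last class this is
     what [has_bridge_le] asks. *)
  have big (i : 'I_(size k)) : 1 < n - nth 0 k i.
    have [p [q [pi qi pq]]] := three col t2 ccol i.
    rewrite -ccol -compl; apply/card_gt1P; exists p, q; rewrite !inE; split=> //.
    by apply: contraNneq pq => ->.
  have k0 : (size k).-1 < size k by rewrite hsize ltn_predL (ltn_trans _ t2).
  have lbig : 1 < n - last 0 k by have := big (Ordinal k0); rewrite /= nth_last.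
  apply: reach_all_multi => //; first exact: three.
  move=> x y xy cxy; set i := col x.
  apply: (@exch_colour_no_bridge _ _ _ _ (n - nth 0 k i)); rewrite ?compl ?ccol //.
  by apply: contra_not nbr; apply: has_bridge_le => //; rewrite leq_sub2l ?kmax.
- move=> t2 _ l2 cX nc nt; apply: FS_multipartite_connected => [|col ccol]; first by rewrite hX.
  apply: reach_all_multi => //; first exact: three.
  move=> x y xy cxy; apply: exch_colour_pair => //.
  + exact: branch_exists.
  + by rewrite hX.
  (* The class contains both [x] and [y] and is no larger than the last part, so it has exactly two
     members. *)
  apply/eqP; rewrite eqn_leq; apply/andP; split; first by rewrite ccol -l2 kmax.
  by apply/card_gt1P; exists x, y; rewrite !inE -cxy eqxx.
Qed.
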